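(* Let $G$ be an infinite graph on countably many vertices, with vertices indexed by $1,2,3,\dots$, and let $\Lambda\subset\mathbb{R}$ be a closed, infinite set of real numbers. Then there exists an unbounded self-adjoint operator $T$ on the Hilbert space $\ell^2$ such that (i) the spectrum of $T$, which coincides with the approximate point spectrum of $T$, equals $\Lambda$; and (ii) the standard matrix of $T$ is a real symmetric matrix whose graph is $G$.
   Context: All vector spaces are over the field of real numbers, and $\ell^2=\ell^2(\mathbb{N})$ is the Hilbert space of square-summable real sequences with standard orthonormal basis $e_1,e_2,\dots$. Graphs are simple and undirected. An unbounded operator $T$ on a Hilbert space $\mathcal H$ is a linear map from a dense subspace $\operatorname{Dom}(T)\subset\mathcal H$ into $\mathcal H$; ''unbounded'' means ''not necessarily bounded'', so bounded operators with $\operatorname{Dom}(T)=\mathcal H$ are allowed. $\operatorname{Dom}(T^* )$ is the set of all $v\in\mathcal H$ for which the linear functional $w\mapsto\langle v,Tw\rangle$, $w\in\operatorname{Dom}(T)$, is bounded, and for such $v$, $T^*v$ is the unique vector with $\langle T^*v,w\rangle=\langle v,Tw\rangle$ for all $w\in\operatorname{Dom}(T)$. $T$ is self-adjoint if $\operatorname{Dom}(T)=\operatorname{Dom}(T^* )$ and $T^*v=Tv$ for all $v\in\operatorname{Dom}(T)$. A number $\lambda\in\mathbb{C}$ is in the resolvent set of $T$ if there is a bounded operator $S$ such that $Sv\in\operatorname{Dom}(T)$ and $(T-\lambda I)Sv=v$ for all $v\in\mathcal H$, and $S(T-\lambda I)w=w$ for all $w\in\operatorname{Dom}(T)$. (For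 non-real $\lambda$ this is understood on the complexification.) The spectrum $\sigma(T)$ is the complement of the resolvent set. The approximate point spectrum of $T$ is the set of $\lambda$ for which there are unit vectors $v_n\in\operatorname{Dom}(T)$ with $\|(T-\lambda I)v_n\|\to0$. The standard matrix of an operator $T$ on $\ell^2$ (with every $e_i\in\operatorname{Dom}(T)$) is $[a_{ij}]_{i,j\ge1}$ with $a_{ij}=\langle e_i,Te_j\rangle$. A graph $G$ with vertices indexed by $1,2,\dots$ is the graph of a real symmetric matrix $[a_{ij}]$ if for all $i\neq j$, $a_{ij}\neq0$ precisely when vertices $i$ and $j$ are adjacent in $G$ (no condition is imposed on diagonal entries). *)

(* Defs.v *)
From HB Require Import structures.
From mathcomp Require Import all_boot all_order all_algebra.
From mathcomp Require Import ring lra complex.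
From mathcomp Require Import all_classical all_reals all_analysis.

Set Implicit Arguments.
Unset Strict Implicit.
Unset Printing Implicit Defensive.

Import Order.TTheory GRing.Theory Num.Theory.
Import numFieldNormedType.Exports.

Local Open Scope classical_set_scope.
Local Open Scope ring_scope.

Definition square_summable (R : realType) : {pred nat -> R^o} :=
  fun u => `[< cvgn (series (fun n => u n ^+ 2 : R^o)) >].

(* Indices start at 0: the usual basis vector $e_i$, i >= 1, is [l2_basis i.-1],
   and vertex $i$ of a graph is the natural number [i.-1]. *)
Record l2 (R : realType) := L2 {
  l2seq :> nat -> R^o ;
  l2P : l2seq \in @square_summable R }.

Section l2_space.
Variable R : realType.

HB.instance Definition _ := [isSub for @l2seq R].
HB.instance Definition _ := [Choice of l2 R by <:].

Lemma l2_mul_cvg (u v : nat -> R^o) :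
  u \in @square_summable R -> v \in @square_summable R ->
  cvgn (series (fun n => u n * v n : R^o)).
Proof.
move=> /asboolP cu /asboolP cv; apply: (@normed_cvg R R^o).
apply: (@series_le_cvg R _ (fun n => u n ^+ 2 + v n ^+ 2)).
- by move=> n; rewrite normr_ge0.
- by move=> n; rewrite addr_ge0// sqr_ge0.
- move=> n; rewrite /= normrM -(real_normK (num_real (u n))).
  by rewrite -(real_normK (num_real (v n))); nra.
- exact: (is_cvg_seriesD cu cv).
Qed.

Lemma square_summable_submod : submod_closed (@square_summable R).
Proof.
split.
  apply/asboolP.
  rewrite (_ : series _ = fun=> 0); first exact: is_cvg_cst.
  by apply/funext => n; rewrite /series /= big1// => i _; rewrite expr0n.
move=> a u v uP vP; apply/asboolP.
have /asboolP cu := uP; have /asboolP cv := vP.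
rewrite (_ : (fun n => _) = a ^+ 2 *: (fun n => u n ^+ 2 : R^o)
  + ((2 * a) *: (fun n => u n * v n : R^o) + (fun n => v n ^+ 2 : R^o))); last first.
  apply/funext => n /=.
  rewrite !fctE /= /GRing.scale /= sqrrD exprMn -addrA; congr (_ + (_ + _)).
  by rewrite -mulrA -mulr_natl !mulrA.
apply: is_cvg_seriesD; first exact: is_cvg_seriesZ.
apply: is_cvg_seriesD => //.
by apply: is_cvg_seriesZ; exact: l2_mul_cvg.
Qed.

HB.instance Definition _ :=
  GRing.isSubmodClosed.Build R (nat -> R^o) (@square_summable R)
    square_summable_submod.
HB.instance Definition _ := [SubChoice_isSubLmodule of l2 R by <:].


Definition l2_dot (u v : l2 R) : R :=
  limn (series (fun n => u n * v n : R^o)).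

Lemma l2_dotC u v : l2_dot u v = l2_dot v u.
Proof. by rewrite /l2_dot; under eq_fun do rewrite mulrC. Qed.

Lemma l2_dotDl u1 u2 v : l2_dot (u1 + u2) v = l2_dot u1 v + l2_dot u2 v.
Proof.
rewrite /l2_dot -lim_seriesD; try exact: l2_mul_cvg (l2P _) (l2P _).
by congr (limn (series _)); apply/funext => n; rewrite !fctE -mulrDl.
Qed.

Lemma l2_dotZl a u v : l2_dot (a *: u) v = a * l2_dot u v.
Proof.
rewrite /l2_dot -[RHS]lim_seriesZ; last exact: l2_mul_cvg (l2P _) (l2P _).
by congr (limn (series _)); apply/funext => n; exact: esym (mulrA a _ _).
Qed.

Lemma l2_dot_ge (u : l2 R) n : u n ^+ 2 <= l2_dot u u.
Proof.
have nd : nondecreasing_seq (series (fun n => u n * u n : R^o)).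
  by apply: nondecreasing_series => i _ _; rewrite -expr2 sqr_ge0.
apply: le_trans (nondecreasing_cvgn_le nd (l2_mul_cvg (l2P u) (l2P u)) n.+1).
rewrite seriesEord/= big_ord_recr/= expr2 lerDr sumr_ge0// => i _.
by rewrite -expr2 sqr_ge0.
Qed.

Lemma l2_dot_ge0 u : 0 <= l2_dot u u.
Proof. exact: le_trans (sqr_ge0 _) (l2_dot_ge u 0). Qed.

Lemma l2_dot_eq0 u : l2_dot u u = 0 -> u = 0.
Proof.
move=> u0; apply: val_inj; apply/funext => n /=; apply/eqP.
by rewrite -sqrf_eq0 eq_le sqr_ge0 andbT -u0 l2_dot_ge.
Qed.

Lemma l2_cauchy_schwarz u v : l2_dot u v ^+ 2 <= l2_dot u u * l2_dot v v.
Proof.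
set a := l2_dot u u; set b := l2_dot u v; set c := l2_dot v v.
have c0 : 0 <= c := l2_dot_ge0 v.
have [cE|c_neq0] := eqVneq c 0.
  have v0 : v = (0 : R) *: (0 : l2 R) by rewrite scaler0; exact: l2_dot_eq0.
  by rewrite cE mulr0 /b v0 l2_dotC l2_dotZl mul0r expr0n.
have : 0 <= l2_dot (c *: u + (- b) *: v) (c *: u + (- b) *: v).
  exact: l2_dot_ge0.
rewrite l2_dotDl !l2_dotZl ![l2_dot _ (_ + _)]l2_dotC !l2_dotDl !l2_dotZl.
rewrite (l2_dotC v u) -/a -/b -/c => h.
have : 0 <= c * (a * c - b ^+ 2) by nra.
by rewrite pmulr_rge0 ?subr_ge0// lt_def c_neq0.
Qed.

Definition l2_norm u := Num.sqrt (l2_dot u u).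

Lemma l2_norm_triangle u v : l2_norm (u + v) <= l2_norm u + l2_norm v.
Proof.
rewrite -(@ler_pXn2r _ 2) ?nnegrE ?addr_ge0 ?sqrtr_ge0// sqrrD.
rewrite !sqr_sqrtr ?l2_dot_ge0// l2_dotDl ![l2_dot _ (_ + _)]l2_dotC !l2_dotDl.
rewrite (l2_dotC v u).
suff : l2_dot u v <= l2_norm u * l2_norm v by lra.
apply: le_trans (ler_norm _) _.
rewrite -sqrtrM ?l2_dot_ge0// -sqrtr_sqr ler_sqrt ?l2_cauchy_schwarz//.
by rewrite mulr_ge0 ?l2_dot_ge0.
Qed.

Lemma l2_normZ a u : l2_norm (a *: u) = `|a| * l2_norm u.
Proof.
rewrite /l2_norm l2_dotZl l2_dotC l2_dotZl mulrA -expr2 sqrtrM ?sqr_ge0//.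
by rewrite sqrtr_sqr.
Qed.

Lemma l2_norm_eq0 u : l2_norm u = 0 -> u = 0.
Proof.
move=> /eqP; rewrite sqrtr_eq0 => u0; apply: l2_dot_eq0.
by apply/eqP; rewrite eq_le u0 l2_dot_ge0.
Qed.

HB.instance Definition _ := Lmodule_isNormed.Build R (l2 R)
  l2_norm_triangle l2_normZ l2_norm_eq0.

Lemma l2_basis_subproof i :
  (fun n => (n == i)%:R : R^o) \in @square_summable R.
Proof.
apply/asboolP; apply: nondecreasing_is_cvgn.
  by apply: nondecreasing_series => n _ _; rewrite sqr_ge0.
exists 1 => _ [n _ <-]; rewrite seriesEnat/=.
have [i_n|n_i] := ltnP i n.
  rewrite (bigD1_seq i) ?mem_index_iota ?iota_uniq//= eqxx expr1n big1 ?addr0//.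
  by move=> j /negbTE ->; rewrite expr0n.
rewrite big_nat big1 ?ler01// => j /andP[_ jn].
by rewrite (ltn_eqF (leq_trans jn n_i)) expr0n.
Qed.

Definition l2_basis i : l2 R := L2 (l2_basis_subproof i).

End l2_space.

Record partial_op (K : pzRingType) (V : lmodType K) := PartialOp {
  dom : set V ;
  opfun :> V -> V ;   (* only the values on [dom] are meaningful *)
  dom0 : dom 0 ;
  domP : forall (a : K) u v, dom u -> dom v -> dom (a *: u + v) ;
  op_linear : forall (a : K) u v, dom u -> dom v ->
    opfun (a *: u + v) = a *: opfun u + opfun v }.

Definition densely_defined (R : realType) (V : normedModType R)
  (T : partial_op V) := dense (dom T).

Section adjoint.
Variables (R : realType) (T : partial_op (l2 R)).

Definition adjoint_dom : set (l2 R) :=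
  [set v | exists M : R, forall w, dom T w -> `|l2_dot v (T w)| <= M * `|w|].

(* For densely defined [T] and [v] in [adjoint_dom] the set below is a
   singleton. *)
Definition adjoint (v : l2 R) : l2 R :=
  xget 0 [set u | forall w, dom T w -> l2_dot u w = l2_dot v (T w)].

Definition self_adjoint :=
  dom T = adjoint_dom /\ forall v, dom T v -> adjoint v = T v.

End adjoint.

(* Generic in the scalars [K], so as to be used over [R] on $\ell^2$ and over
   [R[i]] on its complexification. *)
Section spectral_values.
Variables (R : realType) (K : pzRingType) (V : lmodType K) (nrm : V -> R).
Variables (T : partial_op V) (lambda : K).

Definition resolvent_value :=
  exists S : {linear V -> V},
  [/\ exists M : R, forall v, nrm (S v) <= M * nrm v,
      forall v, dom T (S v) /\ T (S v) - lambda *: S v = v &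
      forall w, dom T w -> S (T w - lambda *: w) = w].

Definition approx_point_value :=
  exists v : nat -> V,
  [/\ forall n, dom T (v n), forall n, nrm (v n) = 1 &
      nrm (T (v n) - lambda *: v n) @[n --> \oo] --> 0].

End spectral_values.

(* The pair (x, y) stands for x + i y. *)
Definition complexification (V : Type) : Type := (V * V)%type.

Section complexification_lmodule.
Variables (R : realType) (V : lmodType R).

HB.instance Definition _ := GRing.Zmodule.on (complexification V).

Definition cplx_scale (z : R[i]) (w : complexification V) :
    complexification V :=
  let: (a +i* b)%C := z in (a *: w.1 - b *: w.2, a *: w.2 + b *: w.1).

Lemma cplx_scaleA z1 z2 w :
  cplx_scale z1 (cplx_scale z2 w) = cplx_scale (z1 * z2) w.
Proof.
case: z1 z2 w => [a b] [c d] [x y]; rewrite /cplx_scale /=.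
by congr (_, _); rewrite !(scalerDr, scalerDl, scalerN, scaleNr, scalerA,
  opprD) -!addrA; congr (_ + _); rewrite [RHS]addrC -addrA.
Qed.

Lemma cplx_scale1 : left_id 1 cplx_scale.
Proof.
by case=> x y; rewrite /cplx_scale /= !scale1r !scale0r subr0 addr0.
Qed.

Lemma cplx_scaleDr : right_distributive cplx_scale +%R.
Proof.
case=> [a b] [x y] [x' y']; rewrite /cplx_scale /=.
by congr (_, _); rewrite /= !(scalerDr, opprD) addrACA.
Qed.

Lemma cplx_scaleDl w : {morph cplx_scale^~ w : z1 z2 / z1 + z2}.
Proof.
case: w => [x y] [a b] [c d]; rewrite /cplx_scale /=.
by congr (_, _); rewrite /= !(scalerDl, opprD) addrACA.
Qed.

HB.instance Definition _ := GRing.Zmodule_isLmodule.Build R[i]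
  (complexification V) cplx_scaleA cplx_scale1 cplx_scaleDr cplx_scaleDl.

End complexification_lmodule.

Section complexification_op.
Variables (R : realType) (V : normedModType R).

Definition cplx_norm (w : complexification V) : R :=
  Num.sqrt (`|w.1| ^+ 2 + `|w.2| ^+ 2).

Variable T : partial_op V.

Definition cplx_dom : set (complexification V) :=
  [set w | dom T w.1 /\ dom T w.2].

Definition cplx_fun (w : complexification V) : complexification V :=
  (T w.1, T w.2).

Lemma cplx_dom0 : cplx_dom 0.
Proof. by split; exact: dom0. Qed.

Lemma domZ a x : dom T x -> dom T (a *: x).
Proof. by move=> Tx; rewrite -[_ *: _]addr0; apply: domP => //; exact: dom0. Qed.

Lemma op0 : T 0 = 0.
Proof.
have := op_linear 1 (dom0 T) (dom0 T); rewrite scaler0 addr0 scale1r => /eqP.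
by rewrite eq_sym -subr_eq0 addrK => /eqP.
Qed.

Lemma opZ a x : dom T x -> T (a *: x) = a *: T x.
Proof.
by move=> Tx; rewrite -[a *: x]addr0 (op_linear _ Tx (dom0 T)) op0 addr0.
Qed.

Lemma cplx_domP (z : R[i]) u v :
  cplx_dom u -> cplx_dom v -> cplx_dom (z *: u + v).
Proof.
case: z u v => [a b] [x y] [x' y'] [/= Tx Ty] [/= Tx' Ty'].
split; rewrite /= -addrA; apply: domP => //; last exact: domP.
by rewrite -scaleNr; exact: domP.
Qed.

Lemma cplx_fun_linear (z : R[i]) u v : cplx_dom u -> cplx_dom v ->
  cplx_fun (z *: u + v) = z *: cplx_fun u + cplx_fun v.
Proof.
case: z u v => [a b] [x y] [x' y'] [/= Tx Ty] [/= Tx' Ty'].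
congr (_, _) => /=; rewrite -!addrA -?scaleNr.
- by rewrite !op_linear//; exact: domP.
- by rewrite !op_linear//; exact: domP.
Qed.

Definition cplx_op : partial_op (complexification V) :=
  PartialOp cplx_dom0 cplx_domP cplx_fun_linear.

End complexification_op.

(* Real values are tested on the real space, non-real ones on the
   complexification. *)
Definition spectrum (R : realType) (V : normedModType R) (T : partial_op V) :
    set R[i] :=
  [set z : R[i] | ~ if complex.Im z == 0
      then resolvent_value (@Num.norm R V) T (complex.Re z)
      else resolvent_value (@cplx_norm R V) (cplx_op T) z].

Definition approx_point_spectrum (R : realType) (V : normedModType R)
    (T : partial_op V) : set R[i] :=
  [set z : R[i] | if complex.Im z == 0
      then approx_point_value (@Num.norm R V) T (complex.Re z)
      else approx_point_value (@cplx_norm R V) (cplx_op T) z].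

Definition std_matrix (R : realType) (T : partial_op (l2 R)) (i j : nat) : R :=
  l2_dot (l2_basis R i) (T (l2_basis R j)).

Definition graph_of_matrix (R : realType) (G : rel nat) (a : nat -> nat -> R) :=
  forall i j, i != j -> (a i j != 0) = G i j.

(* Main.v *)
(* Enumerate a dense subset of Lambda injectively as lam_0, lam_1, ...  One
   builds inductively real symmetric n x n matrices A_n with graph G[0..n-1] and
   eigenvalues lam_0, ..., lam_(n-1): put a tiny weight tau on all the edges from
   vertex n to earlier vertices in the block sum of A_n and (lam_n), and correct
   the diagonal so that the spectrum is restored.  The correction exists because
   the determinants det (lam_i - A) are affine in each diagonal entry and their
   Jacobian with respect to the diagonal stays invertible along the way.

   Off-diagonal entries never change again and diagonal entries move by a
   summable amount, so A_n, completed by diag (lam_n, lam_(n+1), ...), is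
   conjugate to D = diag (lam_0, lam_1, ...) by a finite orthogonal block, and
   these operators converge to T in operator norm.  An operator which is, up to
   arbitrarily small bounded errors, an isometric conjugate of D is self-adjoint,
   and its spectrum is the closure of {lam_i}: the resolvents of the conjugates
   are approximate inverses, made exact by a Neumann series, and images of basis
   vectors are approximate eigenvectors. *)
Require Import Defs.
From HB Require Import structures.
From mathcomp Require Import all_boot all_order all_algebra.
From mathcomp Require Import ring lra complex.
From mathcomp Require Import all_classical all_reals all_analysis.

Set Implicit Arguments.
Unset Strict Implicit.
Unset Printing Implicit Defensive.

Import Order.TTheory GRing.Theory Num.Theory.
Import numFieldNormedType.Exports.

Local Open Scope classical_set_scope.
Local Open Scope ring_scope.

(** * Matrix norm estimates and an implicit function theorem with divided differences *)

Section matrix_analysis.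
Context {R : realType}.

Lemma ler_mx_norm_entry m n (M : 'M[R]_(m, n)) i j : `|M i j| <= `|M|.
Proof.
rewrite [leRHS]/Num.norm /= mx_normrE.
by apply/bigmax_geP; right => /=; exists (i, j).
Qed.

Lemma mx_norm_le m n (M : 'M[R]_(m, n)) e :
  0 <= e -> (forall i j, `|M i j| <= e) -> `|M| <= e.
Proof.
by move=> e0 Me; rewrite [leLHS]/Num.norm /= mx_normrE; apply/bigmax_leP.
Qed.

Lemma mx_norm_mul m n p (A : 'M[R]_(m, n)) (B : 'M[R]_(n, p)) :
  `|A *m B| <= n%:R * (`|A| * `|B|).
Proof.
apply: mx_norm_le => [|i j]; first by rewrite !mulr_ge0.
rewrite mxE (le_trans (ler_norm_sum _ _ _))//.
rewrite -[n in n%:R]card_ord mulr_natl -sumr_const ler_sum// => k _.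
by rewrite normrM ler_pM// ler_mx_norm_entry.
Qed.

Lemma cvg_mx {T : Type} (F : set_system T) {FF : Filter F} m n
    (f : T -> 'M[R]_(m, n)) (l : 'M[R]_(m, n)) :
  (forall i j, f x i j @[x --> F] --> l i j) -> f x @[x --> F] --> l.
Proof.
move=> fl; apply/cvgrPdist_le => e e0.
have fe (ij : 'I_m * 'I_n) :
    \forall x \near F, `|l ij.1 ij.2 - f x ij.1 ij.2| <= e.
  by move/cvgrPdist_le: (fl ij.1 ij.2); apply.
have := filter_forall FF fe; apply: filterS => x xe.
by apply: mx_norm_le => [|i j]; [exact: ltW | rewrite !mxE; exact: (xe (i, j))].
Qed.

Lemma continuous_mx {T : topologicalType} m n (f : T -> 'M[R]_(m, n)) (x : T) :
  (forall i j, {for x, continuous (fun y => f y i j)}) -> {for x, continuous f}.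
Proof. exact: cvg_mx. Qed.

Lemma continuous_mulmxr {T : topologicalType} m n p (f : T -> 'M[R]_(m, n))
    (B : 'M[R]_(n, p)) (x : T) :
  {for x, continuous f} -> {for x, continuous (fun y => f y *m B)}.
Proof.
move=> fx; apply: continuous_mx => i j.
rewrite /prop_for /continuous_at mxE; under eq_fun do rewrite mxE.
apply: cvg_big => [|k _]; first exact: add_continuous.
apply: cvgM; last exact: cvg_cst.
exact: (continuous_comp fx (@coord_continuous _ _ _ i k (f x))).
Qed.

Lemma cvg_det {T : Type} (F : set_system T) {FF : Filter F} n
    (f : T -> 'M[R]_n) (l : 'M[R]_n) :
  (forall i j, f x i j @[x --> F] --> l i j) ->
  \det (f x) @[x --> F] --> \det l.
Proof.
move=> fl; rewrite /determinant; apply: cvg_big => [|s _]; first exact: add_continuous.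
apply: cvgM; first exact: cvg_cst.
by apply: cvg_big => [|i _]; [exact: mul_continuous | exact: fl].
Qed.

(* The solution minimises [d |-> |F t d *m H0^-1|] on a small ball: at a
   nonzero minimum a Newton step would strictly decrease the value. *)
Lemma implicit_divided_differences n (F : R -> 'rV[R]_n -> 'rV[R]_n)
    (H : R -> 'rV[R]_n -> 'rV[R]_n -> 'M[R]_n) (d0 : 'rV[R]_n) :
  (forall t d d', F t d' - F t d = (d' - d) *m H t d d') ->
  (forall t, continuous (F t)) -> F t d0 @[t --> 0] --> (0 : 'rV[R]_n) ->
  H p.1 p.2.1 p.2.2 @[p --> (0 : R, (d0, d0))] --> H 0 d0 d0 ->
  H 0 d0 d0 \in unitmx ->
  forall e, 0 < e -> exists t d,
    [/\ 0 < t < e, `|d - d0| < e, F t d = 0 & H t d d \in unitmx].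
Proof.
move=> FH cF F0 cH H0u e e0; set H0 := H 0 d0 d0 in cH H0u *.
(* [c] bounds right multiplication by [invmx H0]: the factor [n] comes from the entrywise maximum
   norm, and adding 1 makes [c] positive. *)
pose c := n%:R * `|invmx H0| + 1.
have c0 : 0 < c by rewrite ltr_wpDl ?mulr_ge0.
have c1 m (M : 'M[R]_(m, n)) : `|M *m invmx H0| <= c * `|M|.
  rewrite (le_trans (mx_norm_mul _ _))// mulrCA [leLHS]mulrC.
  by rewrite ler_wpM2r// lerDl.
(* Chosen so that [c * n * eta <= 1/2]: near [d0], [1 - H *m invmx H0] then halves norms. The
   [n + 1] keeps the denominator nonzero when [n = 0]. *)
pose eta : R := (2 * c * (n%:R + 1))^-1.
have eta0 : 0 < eta by rewrite invr_gt0 !mulr_gt0// ltr_wpDl.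
have [r [r0 re] Hr] : exists2 r, 0 < r /\ r < e &
    forall t d d', `|t| < r -> `|d - d0| <= r -> `|d' - d0| <= r ->
      `|H t d d' - H0| <= eta.
  move/cvgrPdist_le: cH => /(_ _ eta0) [[A BC] /=].
  move=> [/nbhs_ballP[a /= a0 aA] [[B C] /= [/nbhs_ballP[b /= b0 bB]]]].
  move=> /nbhs_ballP[k /= k0 kC] AB S.
  (* Halving gives [r < e] strictly and puts closed balls of radius [r] inside the open
     neighbourhoods. *)
  exists (Num.min (Num.min a e) (Num.min b k) / 2).
    split; first by rewrite divr_gt0// !lt_min a0 e0 b0 k0.
    rewrite ltr_pdivrMr// !gt_min; apply/orP; left; apply/orP; right.
    by rewrite ltr_pMr// ltr1n.
  set m := Num.min _ _.
  have m0 : 0 < m by rewrite !lt_min a0 e0 b0 k0.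
  have mm : m / 2 < m by rewrite ltr_pdivrMr// ltr_pMr// ltr1n.
  have [ma mb mk] : [/\ m <= a, m <= b & m <= k].
    by rewrite !ge_min !lexx !orbT.
  move=> t d d' tm dm dm'; rewrite distrC; apply: (S (t, (d, d'))); split => /=.
    apply: aA; rewrite -ball_normE/= sub0r normrN.
    by rewrite (lt_le_trans tm)// (le_trans (ltW mm)).
  apply: AB; split => /=.
    apply: bB; rewrite -ball_normE/= distrC.
    by rewrite (le_lt_trans dm)// (lt_le_trans mm).
  apply: kC; rewrite -ball_normE/= distrC.
  by rewrite (le_lt_trans dm')// (lt_le_trans mm).
have half t d d' (u : 'rV[R]_n) : `|t| < r -> `|d - d0| <= r -> `|d' - d0| <= r ->
    `|u *m (1%:M - H t d d' *m invmx H0)| <= 2^-1 * `|u|.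
  move=> tr dr dr'; have -> : 1%:M - H t d d' *m invmx H0
      = (H0 - H t d d') *m invmx H0 by rewrite mulmxBl mulmxV.
  rewrite mulmxA (le_trans (c1 _ _))//.
  rewrite (le_trans (ler_wpM2l (ltW c0) (mx_norm_mul _ _)))//.
  have := Hr _ _ _ tr dr dr'; rewrite distrC => Hle.
  apply: (@le_trans _ _ (c * (n%:R * (`|u| * eta)))).
    by rewrite ler_wpM2l ?(ltW c0)// ler_wpM2l// ler_wpM2l.
  rewrite (_ : c * _ = (c * n%:R * eta) * `|u|); last by ring.
  rewrite ler_wpM2r// /eta ler_pdivrMr; last by rewrite !mulr_gt0// ltr_wpDl.
  have -> : 2^-1 * (2 * c * (n%:R + 1)) = c * (n%:R + 1) by field.
  by rewrite ler_wpM2l ?(ltW c0)// lerDl.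
(* With initial residual at most [r / 4], Newton steps from the ball remain in it, since
   [r / 2 + r / 4 < r]. *)
have [t /andP[t0 tr] Ft] : exists2 t, 0 < t < r & `|F t d0 *m invmx H0| <= r / 4.
  have e1 : 0 < r / 4 / c by rewrite !divr_gt0.
  move/cvgrPdist_le: F0 => /(_ _ e1) /nbhs_ballP[a a0 aS].
  have m0 : 0 < Num.min a r by rewrite lt_min a0 r0.
  have mm : Num.min a r / 2 < Num.min a r by rewrite ltr_pdivrMr// ltr_pMr// ltr1n.
  exists (Num.min a r / 2).
    by rewrite divr_gt0//= (lt_le_trans mm)// ge_min lexx orbT.
  rewrite (le_trans (c1 _ _))// mulrC -ler_pdivlMr//.
  have := aS (Num.min a r / 2); rewrite sub0r normrN; apply.
  rewrite -ball_normE/= sub0r normrN gtr0_norm ?divr_gt0//.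
  by rewrite (lt_le_trans mm)// ge_min lexx.
have tr' : `|t| < r by rewrite gtr0_norm.
pose phi d := `|F t d *m invmx H0|.
have r0' : `|d0 - d0| <= r by rewrite subrr normr0 ltW.
have [p pr pmin] : exists2 p, `|p - d0| <= r &
    forall q, `|q - d0| <= r -> phi p <= phi q.
  pose K : set 'rV[R]_n := closed_ball_ Num.norm d0 r.
  have KE q : (q \in K) = (`|q - d0| <= r).
    by rewrite distrC; apply/idP/idP; rewrite inE.
  have [|||p] := @EVT_min_rV R n phi K.
  - by exists d0 => /=; rewrite /K /closed_ball_/=.
  - apply: bounded_closed_compact; last exact: closed_closed_ball_.
    exists (r + `|d0|); split; first by rewrite num_real.
    move=> x rx y; rewrite /K/closed_ball_/= => Ky.
    rewrite (le_trans _ (ltW rx))// -[y](subrK d0) (le_trans (ler_normD _ _))//.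
    by rewrite lerD2r distrC.
  - apply: continuous_subspaceT => x.
    suff h : F t y *m invmx H0 @[y --> x] --> F t x *m invmx H0.
      exact: (cvg_norm h).
    exact: (continuous_mulmxr (cF t x)).
  - by rewrite KE => pK pm; exists p => // q; rewrite -KE; exact: pm.
(* The Newton step at the minimiser [p], with the Jacobian frozen at [H0]. The divided difference
   identity between [d0] and [p] locates [q]; the one between [p] and [q] gives the value at [q]. *)
pose q := p - F t p *m invmx H0.
have qE : q - d0 = (p - d0) *m (1%:M - H t d0 p *m invmx H0) - F t d0 *m invmx H0.
  rewrite mulmxBr mulmx1 mulmxA -FH mulmxBl opprB /q.
  rewrite -[RHS]addrA [X in _ = _ + X]addrAC subrr sub0r.
  by rewrite addrAC.
have qr : `|q - d0| <= r.
  rewrite qE (le_trans (ler_normB _ _))//.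
  have := half t d0 p (p - d0) tr' r0' pr.
  move: Ft pr => /=; lra.
have Fq : F t q *m invmx H0 = (F t p *m invmx H0) *m (1%:M - H t p q *m invmx H0).
  have qp : q - p = - (F t p *m invmx H0) by rewrite /q addrC addKr.
  rewrite mulmxBr mulmx1 -[in LHS](subrK (F t p) (F t q)) FH qp.
  by rewrite mulmxDl !mulNmx mulmxA addrC.
(* The step at least halves the value, while [p] minimises it over the ball, so the value is
   zero. *)
have F_0 : F t p = 0.
  have := pmin q qr; have := half t p q (F t p *m invmx H0) tr' pr qr.
  rewrite -Fq /phi => h1 h2.
  have : `|F t p *m invmx H0| <= 0 by lra.
  rewrite normr_le0 => /eqP /(congr1 (mulmx^~ H0)).
  by rewrite /= mulmxKV// mul0mx.
have plt : `|p - d0| < r.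
  have : p - d0 = (p - d0) *m (1%:M - H t d0 p *m invmx H0) - F t d0 *m invmx H0.
    by rewrite -qE /q F_0 mul0mx subr0.
  move=> /(congr1 Num.norm) pE; rewrite pE.
  rewrite (le_lt_trans (ler_normB _ _))//.
  have := half t d0 p (p - d0) tr' r0' pr.
  move: Ft pr => /=; lra.
exists t, p; split => //.
- by rewrite t0 (lt_trans tr).
- exact: lt_trans plt _.
(* A vector [u] in the left kernel is fixed by [1 - H *m invmx H0], which halves norms, so
   [u = 0]. *)
- have : row_free (H t p p *m invmx H0).
    rewrite -kermx_eq0; apply/eqP/row_matrixP => i; rewrite row0.
    set u := row i _.
    have u0 : u *m (H t p p *m invmx H0) = 0.
      by rewrite /u -row_mul mulmx_ker row0.
    have := half t p p u tr' pr pr; rewrite mulmxBr u0 mulmx1 subr0 => h.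
    by apply/eqP; rewrite -normr_le0; lra.
  by rewrite row_free_unit unitmx_mul => /andP[].
Qed.

End matrix_analysis.

(** * Perturbing symmetric matrices while keeping prescribed eigenvalues *)

Section isospectral.
Context {R : realType}.

(* The determinant is affine in the [k]-th diagonal entry of [Y], with slope
   [- diag_slope Y k]. *)
Definition diag_slope n (Y : 'M[R]_n) k := \det Y - \det (Y + delta_mx k k).

(** Multilinearity in row [k]: that row of the modified matrix is [- s] times the row of
    [Y + delta_mx k k] plus [1 + s] times the row of [Y], and all other rows agree. *)
Lemma det_add_diag n (Y : 'M[R]_n) k s :
  \det (Y - s *: delta_mx k k) - \det Y = s * diag_slope Y k.
Proof.
rewrite (@determinant_multilinear _ _ _ (Y + delta_mx k k) Y k (- s) (1 + s)).
- by rewrite /diag_slope; ring.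
- by apply/rowP => j; rewrite !mxE; ring.
- apply/matrixP => i j; rewrite !mxE [_ == k]eq_sym (negbTE (neq_lift _ _)).
  by rewrite addr0 mulr0 subr0.
- by apply/matrixP => i j; rewrite !mxE [_ == k]eq_sym (negbTE (neq_lift _ _)) mulr0 subr0.
Qed.

(* The Jacobian of the map sending the diagonal of [A] to the family of the
   [\det ((lam i)%:M - A)]. *)
Definition slope_mx n (lam : 'I_n -> R) (A : 'M[R]_n) :=
  \matrix_(k, i) diag_slope ((lam i)%:M - A) k.

(** The invertible Jacobian is carried along with the eigenvalues because the next perturbation step
    relies on it. *)
Definition regular_spectrum n (lam : 'I_n -> R) (A : 'M[R]_n) :=
  (forall i, \det ((lam i)%:M - A) = 0) /\ slope_mx lam A \in unitmx.

Definition mix_row n (d d' : 'rV[R]_n) k : 'rV[R]_n :=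
  \row_j if (j < k)%N then d' 0 j else d 0 j.

(** Switching the diagonal from [d] to [d'] one entry at a time, each switch is affine in the entry.
    The slopes at the intermediate points [mix_row] are thus exact divided differences, as the
    implicit function argument requires. *)
Lemma det_diag_telescope n (X : 'M[R]_n) (d d' : 'rV[R]_n) :
  \det (X - diag_mx d') - \det (X - diag_mx d) =
  \sum_k (d' - d) 0 k * diag_slope (X - diag_mx (mix_row d d' k)) k.
Proof.
pose f k := \det (X - diag_mx (mix_row d d' k)).
have -> : \det (X - diag_mx d') = f n.
  by congr (\det (_ - diag_mx _)); apply/rowP => j; rewrite mxE ltn_ord.
have -> : \det (X - diag_mx d) = f 0%N.
  by congr (\det (_ - diag_mx _)); apply/rowP => j; rewrite mxE.
rewrite -telescope_sumr// big_mkord; apply: eq_bigr => k _.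
rewrite -det_add_diag; congr (\det _ - _); apply/matrixP => i j; rewrite !mxE.
rewrite -addrA; congr (_ + _); rewrite -opprD; congr (- _).
have [<-{j}|ij] := eqVneq i j; last first.
  rewrite !mulr0n; have [<-|_] := eqVneq i k; last by rewrite mulr0 addr0.
  by rewrite [j == i]eq_sym (negbTE ij) andbF mulr0 addr0.
rewrite !mulr1n andbb ltnS leq_eqVlt; have [->|ik] := eqVneq i k.
  by rewrite eqxx ltnn/= mulr1 [RHS]addrC subrK.
by rewrite (negbTE (ik : i != k :> nat)) /= mulr0 addr0.
Qed.

(** The diagonal correction [d] solves the equations [F t d = 0]. Their divided differences [H]
    reduce to the slope matrix of [A] at the origin, and to that of the new matrix at the solution,
    so regularity survives. *)
Lemma regular_spectrum_perturb n (lam : 'I_n -> R) (A E : 'M[R]_n) :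
  regular_spectrum lam A -> forall e, 0 < e ->
  exists t (d : 'rV[R]_n), [/\ 0 < t < e, forall k, `|d 0 k| < e &
    regular_spectrum lam (A + t *: E + diag_mx d)].
Proof.
move=> [A0 Au] e e0.
pose X t i := (lam i)%:M - (A + t *: E).
pose F t (d : 'rV[R]_n) : 'rV[R]_n := \row_i \det (X t i - diag_mx d).
pose H t (d d' : 'rV[R]_n) : 'M[R]_n :=
  \matrix_(k, i) diag_slope (X t i - diag_mx (mix_row d d' k)) k.
have mixx (d : 'rV[R]_n) k : mix_row d d k = d.
  by apply/rowP => j; rewrite mxE if_same.
have H0E : H 0 0 0 = slope_mx lam A.
  apply/matrixP => k i; rewrite !mxE mixx; congr (diag_slope _ k).
  by rewrite /X scale0r addr0 linear0 subr0.
(* Continuity is proved along arbitrary continuous families, so that the same facts give continuity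
   in [d], in [t], and jointly in [(t, d, d')]. *)
have coordc (T : topologicalType) (f : T -> 'rV[R]_n) (x : T) i j :
    {for x, continuous f} -> {for x, continuous (fun y => f y i j)}.
  by move=> fx; exact: (continuous_comp fx (@coord_continuous _ _ _ i j (f x))).
have Xc (T : topologicalType) (f : T -> R) (x : T) l i j :
    {for x, continuous f} -> {for x, continuous (fun y => X (f y) l i j)}.
  move=> fx; rewrite /prop_for /continuous_at !mxE; under eq_fun do rewrite !mxE.
  apply: cvgB; first exact: cvg_cst.
  apply: cvgD; first exact: cvg_cst.
  by apply: cvgM => //; exact: cvg_cst.
have Xdc (T : topologicalType) (f : T -> R) (g : T -> 'rV[R]_n) (x : T) l i j :
    {for x, continuous f} -> {for x, continuous g} ->
    {for x, continuous (fun y => (X (f y) l - diag_mx (g y)) i j)}.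
  move=> fx gx; have := Xc _ _ _ l i j fx.
  rewrite /prop_for /continuous_at !mxE; under eq_fun do rewrite !mxE.
  move=> Xf; under eq_fun do rewrite !mxE.
  apply: cvgB => //; case: eqP => _; last by rewrite mulr0n; exact: cvg_cst.
  by rewrite mulr1n; under eq_fun do rewrite mulr1n; exact: coordc.
have Fc (T : topologicalType) (f : T -> R) (g : T -> 'rV[R]_n) (x : T) :
    {for x, continuous f} -> {for x, continuous g} ->
    {for x, continuous (fun y => F (f y) (g y))}.
  move=> fx gx; apply: continuous_mx => i j.
  rewrite /prop_for /continuous_at !mxE; under eq_fun do rewrite mxE.
  by apply: cvg_det => k l; exact: Xdc.
have Hc (T : topologicalType) (f : T -> R) (g h : T -> 'rV[R]_n) (x : T) :
    {for x, continuous f} -> {for x, continuous g} -> {for x, continuous h} ->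
    {for x, continuous (fun y => H (f y) (g y) (h y))}.
  move=> fx gx hx; apply: continuous_mx => i j.
  have mc : {for x, continuous (fun y => mix_row (g y) (h y) i)}.
    apply: continuous_mx => k l.
    rewrite /prop_for /continuous_at !mxE; under eq_fun do rewrite mxE.
    by case: ifP => _; exact: coordc.
  rewrite /prop_for /continuous_at !mxE; under eq_fun do rewrite mxE.
  have XH k l := Xdc _ _ _ _ j k l fx mc.
  apply: cvgB; apply: cvg_det => k l; first exact: XH.
  rewrite mxE; under eq_fun do rewrite mxE.
  by apply: cvgD; [exact: XH | exact: cvg_cst].
have F00 : F 0 0 = 0.
  apply/rowP => i; rewrite !mxE /X scale0r addr0 linear0 subr0.
  exact: A0.
have [|||||t [d [te de Ftd Htd]]] :=
  @implicit_divided_differences R n F H 0 _ _ _ _ _ e e0.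
- move=> t d d'; apply/rowP => i.
  rewrite !mxE det_diag_telescope; apply: eq_bigr => k _.
  by rewrite !mxE.
- by move=> t x; apply: (Fc _ (fun=> t) id); [exact: cst_continuous | exact: cvg_id].
- have := Fc R id (fun=> 0) 0; rewrite /prop_for /continuous_at F00; apply.
    exact: cvg_id.
  exact: cst_continuous.
- pose p0 : R * ('rV[R]_n * 'rV[R]_n) := (0, (0, 0)).
  have c1 : {for p0, continuous (fun p : R * ('rV[R]_n * 'rV[R]_n) => p.1)}.
    exact: cvg_fst.
  have c2 : {for p0, continuous (fun p : R * ('rV[R]_n * 'rV[R]_n) => p.2.1)}.
    by apply: (@continuous_comp _ _ _ snd fst); [exact: cvg_snd | exact: cvg_fst].
  have c3 : {for p0, continuous (fun p : R * ('rV[R]_n * 'rV[R]_n) => p.2.2)}.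
    by apply: (@continuous_comp _ _ _ snd snd); [exact: cvg_snd | exact: cvg_snd].
  exact: (Hc _ _ _ _ _ c1 c2 c3).
- by rewrite H0E.
exists t, d; split => //.
  move=> k; rewrite (le_lt_trans _ de)// subr0; exact: ler_mx_norm_entry.
split.
  by move=> i; move/rowP: Ftd => /(_ i); rewrite opprD addrA !mxE.
rewrite (_ : slope_mx _ _ = H t d d)//; apply/matrixP => k i; rewrite !mxE mixx.
by rewrite /X [in LHS]opprD addrA.
Qed.

Lemma det_row_last n (B : 'M[R]_n.+1) :
  (forall j, B ord_max (lift ord_max j) = 0) ->
  \det B = B ord_max ord_max * \det (row' ord_max (col' ord_max B)).
Proof.
move=> B0; rewrite (expand_det_row B ord_max) (bigD1 ord_max)//= big1 ?addr0.
  by rewrite /cofactor -signr_odd oddD addbb mul1r.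
by move=> j; case: (unliftP ord_max j) => [k ->|->]; rewrite ?eqxx// B0 mul0r.
Qed.

Lemma det_scalar_sub_eq0 n (A : 'M[R]_n) a :
  (\det (a%:M - A) == 0) = eigenvalue A a.
Proof.
rewrite /eigenvalue /eigenspace kermx_eq0 row_free_unit unitmxE unitfE negbK.
by rewrite -opprB -scaleN1r detZ mulf_eq0 expf_eq0 oppr_eq0 oner_eq0 andbF.
Qed.

Lemma size_eigenvalues n (A : 'M[R]_n) s :
  uniq s -> all (eigenvalue A) s -> (size s <= n)%N.
Proof.
move=> us /allP sA; rewrite -ltnS -(size_char_poly A).
apply: max_poly_roots => //; first exact/monic_neq0/char_poly_monic.
by apply/allP => x /sA; rewrite eigenvalue_root_char.
Qed.

(** The last row of [B] vanishes off the diagonal, so characteristic determinants factor through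
    [a - lam n]. The slope matrix is block triangular too: its corner is [- \det (lam n - A)] and
    its main block is the slope matrix of [A] with columns scaled by [lam i - lam n]. *)
Lemma regular_spectrum_extend n (lam : nat -> R) (A : 'M[R]_n) (B : 'M[R]_n.+1) :
  injective lam -> regular_spectrum (fun i : 'I_n => lam i) A ->
  row' ord_max (col' ord_max B) = A ->
  (forall j, B ord_max (lift ord_max j) = 0) -> B ord_max ord_max = lam n ->
  regular_spectrum (fun i : 'I_n.+1 => lam i) B.
Proof.
move=> lamI [A0 Au] BA B0 Bn.
have detB a : \det (a%:M - B) = (a - lam n) * \det (a%:M - A).
  rewrite det_row_last => [|j]; last first.
    by rewrite !mxE (negbTE (neq_lift _ _)) B0 mulr0n subr0.
  rewrite !mxE eqxx mulr1n Bn; congr (_ * \det _).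
  rewrite -BA; apply/matrixP => i j; rewrite !mxE.
  by rewrite (inj_eq lift_inj).
have slope a k : diag_slope (a%:M - B) (lift ord_max k)
    = (a - lam n) * diag_slope (a%:M - A) k.
  rewrite /diag_slope mulrBr detB; congr (_ - _).
  rewrite det_row_last => [|j]; last first.
    by rewrite !mxE !(negbTE (neq_lift _ _)) B0 mulr0n subr0 addr0.
  rewrite !mxE eqxx mulr1n Bn (negbTE (neq_lift _ _)) addr0; congr (_ * \det _).
  rewrite -BA; apply/matrixP => i j; rewrite !mxE.
  by rewrite !(inj_eq lift_inj).
have slope_max a : diag_slope (a%:M - B) ord_max = - \det (a%:M - A).
  rewrite /diag_slope detB det_row_last => [|j]; last first.
    rewrite !mxE !(negbTE (neq_lift _ _)) B0 mulr0n subr0 [lift _ _ == _]eq_sym.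
    by rewrite (negbTE (neq_lift _ _)) andbF addr0.
  rewrite !mxE eqxx/= mulr1n Bn.
  rewrite (_ : row' ord_max (col' ord_max _) = a%:M - A); first by ring.
  rewrite -BA; apply/matrixP => i j; rewrite !mxE.
  by rewrite (inj_eq lift_inj) [lift _ _ == ord_max]eq_sym (negbTE (neq_lift _ _)) addr0.
have lift_val (i : 'I_n) : lift ord_max i = i :> nat by rewrite lift_max.
(* Otherwise [A] would have [n + 1] distinct eigenvalues. *)
have lamn : \det ((lam n)%:M - A) != 0.
  apply/negP; rewrite det_scalar_sub_eq0 => ln.
  have := @size_eigenvalues n A [seq lam i | i <- iota 0 n.+1].
  rewrite map_inj_uniq// iota_uniq size_map size_iota ltnn => H.
  suff : false by []; apply: H => //.
  apply/allP => _ /mapP[i + ->]; rewrite mem_iota => /andP[_].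
  rewrite add0n ltnS leq_eqVlt => /orP[/eqP->//|ni].
  by rewrite -det_scalar_sub_eq0 (A0 (Ordinal ni)).
split.
  move=> i; rewrite detB; case: (unliftP ord_max i) => [k ->|->].
    by rewrite lift_val A0 mulr0.
  by rewrite /= subrr mul0r.
rewrite unitmxE unitfE det_row_last => [|j]; last first.
  by rewrite mxE slope_max lift_val A0 oppr0.
rewrite mulf_neq0 ?mxE ?slope_max ?oppr_eq0//.
rewrite (_ : row' ord_max (col' ord_max _) = slope_mx (fun i : 'I_n => lam i) A *m
    diag_mx (\row_i (lam i - lam n))); last first.
  by apply/matrixP => i j; rewrite mul_mx_diag !mxE slope lift_val mulrC.
rewrite det_mulmx det_diag mulf_neq0//; first by rewrite -unitfE -unitmxE.
apply/prodf_neq0 => i _; rewrite mxE subr_eq0 (inj_eq lamI).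
by rewrite (ltn_eqF (ltn_ord i)).
Qed.

(** Eigenvectors of a symmetric matrix for distinct eigenvalues are orthogonal, and here there are
    [n] of them. Normalised, they are the rows of [Q]. *)
Lemma orthogonal_diagonalization n (lam : 'I_n -> R) (A : 'M[R]_n) :
  injective lam -> A^T = A -> (forall i, \det ((lam i)%:M - A) = 0) ->
  exists Q : 'M[R]_n, Q *m Q^T = 1%:M /\ Q *m A = diag_mx (\row_i lam i) *m Q.
Proof.
move=> lamI As Alam.
have /choice[v vP] : forall i, exists v : 'rV[R]_n,
    v *m A = lam i *: v /\ v *m v^T = 1%:M.
  move=> i; have /eigenvalueP[v vA v0] : eigenvalue A (lam i).
    by rewrite -det_scalar_sub_eq0 Alam.
  pose s := (v *m v^T) 0 0.
  have sE : s = \sum_j v 0 j ^+ 2.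
    by rewrite /s mxE; apply: eq_bigr => j _; rewrite mxE expr2.
  have s0 : 0 < s.
    rewrite lt_def sE sumr_ge0 ?andbT => [|j _]; last exact: sqr_ge0.
    apply: contra v0; rewrite psumr_eq0 => [/allP h|j _]; last exact: sqr_ge0.
    apply/eqP/rowP => j; rewrite mxE; apply/eqP; rewrite -sqrf_eq0.
    by apply: h; rewrite mem_index_enum.
  exists ((Num.sqrt s)^-1 *: v); split.
    by rewrite -scalemxAl vA scalerA mulrC -scalerA.
  rewrite linearZ /= -scalemxAl -scalemxAr scalerA -expr2 exprVn sqr_sqrtr ?ltW//.
  by rewrite [v *m _]mx11_scalar -/s scale_scalar_mx mulVf// gt_eqF.
pose Q : 'M[R]_n := \matrix_(i, j) v i 0 j.
have rQ i : row i Q = v i by apply/rowP => j; rewrite !mxE.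
exists Q; split; last first.
  apply/row_matrixP => i; rewrite row_mul rQ (vP i).1.
  by apply/rowP => j; rewrite mul_diag_mx !mxE.
apply/matrixP => i j.
have -> : (Q *m Q^T) i j = (v i *m (v j)^T) 0 0.
  by rewrite !mxE; apply: eq_bigr => k _; rewrite !mxE.
have [<-{j}|ij] := eqVneq i j; first by rewrite (vP i).2 !mxE !eqxx.
rewrite !mxE (negbTE ij) mulr0n.
(* Both sides equal [v i *m A *m (v j)^T], letting the symmetric [A] act to the left or to the
   right. *)
have : lam i * (v i *m (v j)^T) 0 0 = lam j * (v i *m (v j)^T) 0 0.
  have : (v i *m A *m (v j)^T) 0 0 = (v i *m A^T *m (v j)^T) 0 0 by rewrite As.
  rewrite -[in RHS]mulmxA -trmx_mul !(fun i => (vP i).1).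
  by rewrite linearZ /= -scalemxAl -scalemxAr !mxE.
move=> /eqP; rewrite -subr_eq0 -mulrBl mulf_eq0 subr_eq0 (inj_eq lamI) (negbTE ij).
by rewrite mxE => /eqP.
Qed.

End isospectral.

(** * Completeness for sequences with geometrically decreasing increments *)

Section geometric_cauchy.
Context {R : realType}.

(** The norm is a bare function, so that the notion covers both the norm of [l2] and [cplx_norm]. *)
Definition geo_complete (V : zmodType) (nrm : V -> R) :=
  forall (y : nat -> V) c, (forall k, nrm (y k.+1 - y k) <= c / 2 ^+ k) ->
  exists l C, forall k, nrm (y k - l) <= C / 2 ^+ k.

Lemma half_expS (c : R) k : c / 2 ^+ k.+1 = c / 2 ^+ k / 2.
Proof. by rewrite exprSr invfM mulrA. Qed.

Lemma geo_small (c e : R) : 0 < e -> exists N, forall m, (N <= m)%N -> c / 2 ^+ m < e.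
Proof.
move=> e0; exists (Num.bound (c / e)) => m Nm.
have le2 : c / e < 2 ^+ m.
  have [ce|ce] := ltP (c / e) 0; first by rewrite (lt_trans ce) ?exprn_gt0.
  rewrite (lt_le_trans (archi_boundP ce))//.
  rewrite -natrX ler_nat (leq_trans Nm)// ltnW//; exact: ltn_expl.
by rewrite ltr_pdivrMr ?exprn_gt0// mulrC -ltr_pdivrMr.
Qed.

Lemma geo_cauchy_real (y : nat -> R) c :
  (forall k, `|y k.+1 - y k| <= c / 2 ^+ k) ->
  exists l, forall k, `|y k - l| <= 2 * c / 2 ^+ k.
Proof.
(* [r k] is the sum of all increment bounds from [k] on. The intervals of radius [r k] around [y k]
   are nested, and the limit is the supremum of their left ends. *)
move=> yc; pose r k := 2 * (c / 2 ^+ k).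
have ystep k : y k.+1 + r k.+1 <= y k + r k /\ y k - r k <= y k.+1 - r k.+1.
  have := yc k; rewrite ler_norml /r !half_expS => /andP[].
  by set z := (c / 2 ^+ k); split; lra.
have r0 k : 0 <= r k.
  by rewrite /r mulr_ge0// (le_trans (normr_ge0 _) (yc k)).
have up k m : (k <= m)%N -> y m + r m <= y k + r k.
  elim: m => [|m IH]; first by rewrite leqn0 => /eqP ->.
  by rewrite leq_eqVlt ltnS => /orP[/eqP<-//|/IH]; have := ystep m; lra.
have dn k m : (k <= m)%N -> y k - r k <= y m - r m.
  elim: m => [|m IH]; first by rewrite leqn0 => /eqP ->.
  by rewrite leq_eqVlt ltnS => /orP[/eqP<-//|/IH]; have := ystep m; lra.
pose W := range (fun k => y k - r k).
have Wub k : ubound W (y k + r k).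
  move=> _ [m _ <-]; have := dn m _ (leq_maxl m k); have := up k _ (leq_maxr m k).
  by have := r0 (maxn m k); lra.
exists (sup W) => k; rewrite -mulrA -/(r k) ler_distlC; apply/andP; split.
  by apply: ub_le_sup; [exists (y 0%N + r 0%N); exact: Wub | exists k].
by apply: ge_sup; [exists (y 0%N - r 0%N); exists 0%N | exact: Wub].
Qed.

End geometric_cauchy.

(** * Norm, coordinates and completeness of the sequence space *)

Section l2_theory.
Context {R : realType}.
Implicit Types u v w : l2 R.

Lemma l2_normE u : `|u| = Num.sqrt (l2_dot u u).
Proof. by []. Qed.

Lemma l2_norm_sqr u : `|u| ^+ 2 = l2_dot u u.
Proof. by rewrite l2_normE sqr_sqrtr// l2_dot_ge0. Qed.

Lemma l2_addE u v i : (u + v) i = u i + v i. Proof. by []. Qed.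
Lemma l2_oppE u i : (- u) i = - u i. Proof. by []. Qed.
Lemma l2_scaleE (a : R) u i : (a *: u) i = a * u i. Proof. by []. Qed.

Lemma l2_eq u v : (forall i, u i = v i) -> u = v.
Proof. by move=> uv; apply: val_inj; apply/funext. Qed.

Lemma l2_sum_le u N : \sum_(i < N) u i ^+ 2 <= `|u| ^+ 2.
Proof.
rewrite l2_norm_sqr.
have nd : nondecreasing_seq (series (fun n => u n * u n : R^o)).
  by apply: nondecreasing_series => i _ _; rewrite -expr2 sqr_ge0.
apply: le_trans (nondecreasing_cvgn_le nd (l2_mul_cvg (l2P u) (l2P u)) N).
by rewrite seriesEord/=; under eq_bigr do rewrite expr2.
Qed.

Lemma l2_norm_le u c :
  0 <= c -> (forall N, \sum_(i < N) u i ^+ 2 <= c ^+ 2) -> `|u| <= c.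
Proof.
move=> c0 uc; rewrite -(@ler_pXn2r _ 2) ?nnegrE// l2_norm_sqr.
apply: limr_le; first exact: l2_mul_cvg (l2P _) (l2P _).
apply: nearW => N; rewrite seriesEord/=.
by under eq_bigr do rewrite -expr2; exact: uc.
Qed.

Lemma square_summable_bound (f : nat -> R) c :
  (forall N, \sum_(i < N) f i ^+ 2 <= c) -> f \in @square_summable R.
Proof.
move=> fc; apply/asboolP; apply: nondecreasing_is_cvgn.
  by apply: nondecreasing_series => n _ _; rewrite sqr_ge0.
by exists c => _ [N _ <-]; rewrite seriesEord /=; exact: fc.
Qed.

(** Total, with value 0 on sequences that are not square summable; the lock keeps it from
    unfolding. *)
Definition to_l2 (f : nat -> R) : l2 R :=
  locked (insubd (0 : l2 R) (f : nat -> R^o)).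

Lemma to_l2E (f : nat -> R) i : f \in @square_summable R -> to_l2 f i = f i.
Proof.
by move=> fs; rewrite /to_l2 -lock /insubd (insubT (fun x => x \in _) fs).
Qed.

Lemma square_summable_le (f : nat -> R) u K :
  (forall i, `|f i| <= K * `|u i|) -> f \in @square_summable R.
Proof.
move=> fK; apply: (@square_summable_bound _ (K ^+ 2 * `|u| ^+ 2)) => N.
rewrite (le_trans _ (ler_wpM2l (sqr_ge0 K) (l2_sum_le u N)))// mulr_sumr.
apply: ler_sum => i _; rewrite -(real_normK (num_real (f i))).
rewrite -(real_normK (num_real (u i))) -exprMn.
by rewrite lerXn2r ?nnegrE ?fK// (le_trans _ (fK i)).
Qed.

Lemma l2_norm_le_mul u v K : 0 <= K ->
  (forall i, `|u i| <= K * `|v i|) -> `|u| <= K * `|v|.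
Proof.
move=> K0 uv; apply: l2_norm_le => [|N]; first by rewrite mulr_ge0.
rewrite exprMn (le_trans _ (ler_wpM2l (sqr_ge0 K) (l2_sum_le v N)))// mulr_sumr.
apply: ler_sum => i _; rewrite -(real_normK (num_real (u i))).
rewrite -(real_normK (num_real (v i))) -exprMn.
by rewrite lerXn2r ?nnegrE ?uv// (le_trans _ (uv i)).
Qed.

Lemma l2_dot_le u v : `|l2_dot u v| <= `|u| * `|v|.
Proof.
rewrite -(@ler_pXn2r _ 2) ?nnegrE ?mulr_ge0// real_normK ?num_real//.
by rewrite exprMn !l2_norm_sqr l2_cauchy_schwarz.
Qed.

Lemma l2_dotDr u v w : l2_dot u (v + w) = l2_dot u v + l2_dot u w.
Proof. by rewrite ![l2_dot u _]l2_dotC l2_dotDl. Qed.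

Lemma l2_dotZr (a : R) u v : l2_dot u (a *: v) = a * l2_dot u v.
Proof. by rewrite ![l2_dot u _]l2_dotC l2_dotZl. Qed.

Lemma l2_dotNr u v : l2_dot u (- v) = - l2_dot u v.
Proof. by rewrite -scaleN1r l2_dotZr mulN1r. Qed.

Lemma l2_dotNl u v : l2_dot (- u) v = - l2_dot u v.
Proof. by rewrite l2_dotC l2_dotNr l2_dotC. Qed.

Lemma l2_coord_le u i : `|u i| <= `|u|.
Proof.
rewrite -(@ler_pXn2r _ 2) ?nnegrE// real_normK ?num_real//.
by rewrite l2_norm_sqr l2_dot_ge.
Qed.

Lemma l2_dot_finite u v n : (forall i, (n <= i)%N -> u i = 0) ->
  l2_dot u v = \sum_(i < n) u i * v i.
Proof.
move=> u0; apply: cvg_lim => //.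
apply: cvg_near_cst; near=> N.
have nN : (n <= N)%N by near: N; exact: nbhs_infty_ge.
rewrite seriesEnat/= (big_cat_nat (leq0n n) nN)//= [X in _ + X]big_nat.
rewrite [X in _ + X]big1 => [|i /andP[ni _]].
  by rewrite addr0 big_mkord.
by rewrite u0// mul0r.
Unshelve. all: by end_near. Qed.

Lemma l2_basisE i n : l2_basis R i n = (n == i)%:R. Proof. by []. Qed.

Lemma l2_dot_basis u i : l2_dot (l2_basis R i) u = u i.
Proof.
rewrite (@l2_dot_finite _ _ i.+1) => [|n].
  rewrite big_ord_recr/= eqxx mul1r big1 ?add0r// => j _.
  by rewrite /= ltn_eqF// mul0r.
by rewrite /= => ni; rewrite gtn_eqF.
Qed.

Lemma l2_norm_basis i : `|l2_basis R i| = 1.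
Proof. by rewrite l2_normE l2_dot_basis l2_basisE eqxx sqrtr1. Qed.

(** Coordinates converge by the real case. The rate is obtained on finite partial sums, where the
    limit can be taken termwise, with a bound independent of their length. *)
Lemma geo_complete_l2 : geo_complete (fun u : l2 R => `|u|).
Proof.
move=> y c yc.
have c0 : 0 <= c by have := yc 0%N; rewrite expr0 divr1; apply: le_trans.
have /choice[l lP] : forall i, exists l, forall k, `|y k i - l| <= 2 * c / 2 ^+ k.
  move=> i; apply: (@geo_cauchy_real _ (fun k => y k i)) => k.
  exact: le_trans (l2_coord_le (y k.+1 - y k) i) (yc k).
have yl i : y m i @[m --> \oo] --> l i.
  apply/cvgrPdist_lt => e e0; have [N NP] := geo_small (2 * c) e0.
  near=> m; rewrite distrC (le_lt_trans (lP i m))//; apply: NP.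
  by near: m; exact: nbhs_infty_ge.
(* Keeping the exact geometric sum as a difference makes the induction close. *)
have ykm k j : `|y k - y (k + j)%N| <= 2 * c / 2 ^+ k - 2 * c / 2 ^+ (k + j).
  rewrite -!(mulrA 2); elim: j => [|j IH]; first by rewrite addn0 !subrr normr0.
  rewrite addnS half_expS -(subrKA (y (k + j)%N)) (le_trans (ler_normD _ _))//.
  have := yc (k + j)%N; rewrite distrC.
  by move: IH; set z := (c / _); set z' := (c / _); lra.
have sumle k N : \sum_(i < N) (y k i - l i) ^+ 2 <= (2 * c / 2 ^+ k) ^+ 2.
  have : \sum_(i < N) (y k i - y m i) ^+ 2 @[m --> \oo]
      --> \sum_(i < N) (y k i - l i) ^+ 2.
    apply: cvg_big => [|i _]; first exact: add_continuous.
    rewrite expr2; under eq_fun do rewrite expr2.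
    by apply: cvgM; apply: cvgB => //; exact: cvg_cst.
  move=> /cvgr_to_le; apply; near=> m.
  have km : (k <= m)%N by near: m; exact: nbhs_infty_ge.
  rewrite (le_trans (l2_sum_le (y k - y m) N))//.
  rewrite lerXn2r ?nnegrE ?divr_ge0 ?mulr_ge0 ?exprn_ge0//.
  rewrite -(subnKC km) (le_trans (ykm _ _))// lerBlDr lerDl.
  by rewrite divr_ge0 ?mulr_ge0 ?exprn_ge0.
have ls : l \in @square_summable R.
  have s0 : (fun i => y 0%N i - l i) \in @square_summable R.
    exact: (square_summable_bound (sumle 0%N)).
  have -> : l = (y 0%N : nat -> R^o) - (fun i => y 0%N i - l i).
    by apply/funext => i; rewrite !fctE subKr.
  by apply: rpredB => //; exact: l2P.
exists (L2 ls), (2 * c) => k; apply: l2_norm_le; last exact: sumle.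
by rewrite divr_ge0 ?mulr_ge0 ?exprn_ge0.
Unshelve. all: by end_near. Qed.

End l2_theory.

(** * From an approximate inverse to the resolvent *)

Section approximate_inverse.
Context {R : realType} {K : comPzRingType} {V : lmodType K} (nrm : V -> R).
Hypothesis nrm_ge0 : forall u, 0 <= nrm u.
Hypothesis nrm_eq0 : forall u, nrm u = 0 -> u = 0.
Hypothesis nrmN : forall u, nrm (- u) = nrm u.
Hypothesis nrmD : forall u v, nrm (u + v) <= nrm u + nrm v.
Hypothesis nrm_complete : geo_complete nrm.

(* Neumann series: the exact inverse at [v] is [S] applied to the fixed point
   of [y |-> v + (y - (T - lambda) S y)]. *)
Lemma resolvent_of_approximate_inverse (T : partial_op V) (lambda : K)
    (S : V -> V) (M : R) :
  (forall a u v, S (a *: u + v) = a *: S u + S v) ->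
  (forall v, dom T (S v)) -> (forall v, nrm (S v) <= M * nrm v) ->
  (forall v, nrm (T (S v) - lambda *: S v - v) <= nrm v / 2) ->
  (forall w, dom T w -> nrm (S (T w - lambda *: w) - w) <= nrm w / 2) ->
  resolvent_value nrm T lambda.
Proof.
move=> Slin Sdom SM right left.
have small0 u (c : R) : (forall k, nrm u <= c / 2 ^+ k) -> u = 0.
  move=> uc; apply: nrm_eq0; apply/eqP; rewrite eq_le nrm_ge0 andbT leNgt.
  apply/negP => u0; have [N /(_ N (leqnn N))] := geo_small c u0.
  by rewrite ltNge uc.
have subE u v : u - v = (-1) *: v + u by rewrite scaleN1r addrC.
pose L w := T w - lambda *: w.
have Llin a u v : dom T u -> dom T v -> L (a *: u + v) = a *: L u + L v.
  move=> du dv; rewrite /L op_linear// !scalerDr scalerN opprD !scalerA.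
  by rewrite [a * _]mulrC addrACA.
(* If [L w = 0], the left estimate reads [nrm w <= nrm w / 2]. *)
have Linj u v : dom T u -> dom T v -> L u = L v -> u = v.
  move=> du dv uv; apply/eqP; rewrite -subr_eq0; apply/eqP.
  have dw : dom T (u - v) by rewrite subE; exact: domP.
  have Lw : L (u - v) = 0 by rewrite subE Llin// scaleN1r uv addNr.
  have S0 : S 0 = 0.
    have := Slin 1 0 0; rewrite scaler0 addr0 scale1r => /eqP.
    by rewrite eq_sym -subr_eq0 addrK => /eqP.
  apply: nrm_eq0; have := left _ dw; rewrite -/(L _) Lw S0 sub0r nrmN.
  by have := nrm_ge0 (u - v); move: (nrm _) => z; lra.
have surj v : exists w, dom T w /\ L w = v.
  pose k y := y - L (S y).
  have klin a u w : k (a *: u + w) = a *: k u + k w.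
    by rewrite /k Slin Llin// scalerBr opprD addrACA.
  have kB u w : k (u - w) = k u - k w by rewrite subE klin scaleN1r addrC.
  have k2 y : nrm (k y) <= nrm y / 2 by rewrite -nrmN opprB; exact: right.
  pose y n := iter n (fun z => v + k z) v.
  have yS n : y n.+1 = v + k (y n) by [].
  have yc n : nrm (y n.+1 - y n) <= nrm v / 2 ^+ n.
    elim: n => [|n IH].
      rewrite expr0 divr1 yS addrC addrA addNr add0r (le_trans (k2 _))//.
      by have := nrm_ge0 v; move: (nrm v) => z; lra.
    rewrite half_expS !yS opprD addrACA subrr add0r -kB (le_trans (k2 _))//.
    by rewrite ler_pM2r.
  have [l [C lC]] := nrm_complete yc.
  have lE : l = v + k l.
    apply/eqP; rewrite -subr_eq0; apply/eqP.
    apply: (@small0 _ C) => n.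
    rewrite -(subrKA (y n.+1)) (le_trans (nrmD _ _))// -nrmN opprB.
    have -> : y n.+1 - (v + k l) = k (y n - l) by rewrite yS kB opprD addrACA subrr add0r.
    have := lC n.+1; have := k2 (y n - l); have := lC n.
    rewrite half_expS; move: (C / _) (nrm _) (nrm _) (nrm _) => z1 z2 z3 z4; lra.
  exists (S l); split => //; move/eqP: lE; rewrite /k addrCA -subr_eq0.
  by rewrite opprD addrA subrr add0r oppr_eq0 subr_eq0 => /eqP.
have /choice[S' S'P] := surj.
have S'lin a u v : S' (a *: u + v) = a *: S' u + S' v.
  have [[du Lu] [dv Lv]] := (S'P u, S'P v); have [duv Luv] := S'P (a *: u + v).
  by apply: Linj; [|exact: domP | rewrite Luv Llin// Lu Lv].
pose Sl : {linear V -> V} := HB.pack S' (GRing.isLinear.Build K V V _ S' S'lin).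
exists Sl; split.
(* The left estimate at [S' v] puts [S v] within half the norm of [S' v], hence the factor 2. *)
- exists (2 * M) => v; change (nrm (S' v) <= 2 * M * nrm v); have [dw Lw] := S'P v.
  have := left _ dw; rewrite -/(L _) Lw => h; have := SM v.
  have : nrm (S' v) <= nrm (S v) + nrm (S v - S' v).
    by rewrite -[in leLHS](subKr (S v) (S' v)) (le_trans (nrmD _ _))// nrmN.
  move: h; rewrite -mulrA; move: (M * _) (nrm _) (nrm _) (nrm _) => z1 z2 z3 z4; lra.
- by move=> v; have [dw Lw] := S'P v.
- move=> w dw; have [dw' Lw'] := S'P (T w - lambda *: w).
  exact: (Linj (S' _)).
Qed.

End approximate_inverse.

(** * The norm of the complexification *)

Section cplx_norm_theory.
Context {R : realType}.
Implicit Types w : complexification (l2 R).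

Lemma cplx_norm_ge0 w : 0 <= cplx_norm w.
Proof. exact: sqrtr_ge0. Qed.

Lemma cplx_norm_sqr w : cplx_norm w ^+ 2 = `|w.1| ^+ 2 + `|w.2| ^+ 2.
Proof. by rewrite sqr_sqrtr// addr_ge0 ?sqr_ge0. Qed.

Lemma cplx_norm_le w c : 0 <= c ->
  `|w.1| ^+ 2 + `|w.2| ^+ 2 <= c ^+ 2 -> cplx_norm w <= c.
Proof.
by move=> c0 h; rewrite -(@ler_pXn2r _ 2) ?nnegrE ?cplx_norm_ge0// cplx_norm_sqr.
Qed.

Lemma cplx_norm_fst w : `|w.1| <= cplx_norm w.
Proof.
rewrite -(@ler_pXn2r _ 2) ?nnegrE ?cplx_norm_ge0// cplx_norm_sqr.
by rewrite lerDl sqr_ge0.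
Qed.

Lemma cplx_norm_snd w : `|w.2| <= cplx_norm w.
Proof.
rewrite -(@ler_pXn2r _ 2) ?nnegrE ?cplx_norm_ge0// cplx_norm_sqr.
by rewrite lerDr sqr_ge0.
Qed.

Lemma cplx_norm_le_sum w : cplx_norm w <= `|w.1| + `|w.2|.
Proof.
apply: cplx_norm_le; first exact: addr_ge0.
have := normr_ge0 w.1; have := normr_ge0 w.2.
by move: (`|w.1|) (`|w.2|) => x y y0 x0; nra.
Qed.

Lemma cplx_norm_le_mul w w' k : 0 <= k ->
  `|w.1| <= k * `|w'.1| -> `|w.2| <= k * `|w'.2| -> cplx_norm w <= k * cplx_norm w'.
Proof.
move=> k0 h1 h2; apply: cplx_norm_le; first by rewrite mulr_ge0 ?cplx_norm_ge0.
rewrite exprMn cplx_norm_sqr mulrDr -!exprMn.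
by apply: lerD; rewrite lerXn2r ?nnegrE// mulr_ge0.
Qed.

Lemma cplx_norm_eq0 w : cplx_norm w = 0 -> w = 0.
Proof.
case: w => x y w0; have := cplx_norm_fst (x, y); have := cplx_norm_snd (x, y).
by rewrite w0 !normr_le0 /= => /eqP -> /eqP ->.
Qed.

Lemma cplx_normN w : cplx_norm (- w) = cplx_norm w.
Proof. by rewrite /cplx_norm !normrN. Qed.

Lemma cplx_normD w w' : cplx_norm (w + w') <= cplx_norm w + cplx_norm w'.
Proof.
apply: cplx_norm_le; first by rewrite addr_ge0 ?cplx_norm_ge0.
rewrite sqrrD !cplx_norm_sqr.
have [n1 n2] : `|w.1 + w'.1| <= `|w.1| + `|w'.1| /\ `|w.2 + w'.2| <= `|w.2| + `|w'.2|.
  by split; exact: ler_normD.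
(* Cauchy-Schwarz in the plane by the Lagrange identity: after squaring, the gap is the square
   supplied to [nra]. *)
have CS : `|w.1| * `|w'.1| + `|w.2| * `|w'.2| <= cplx_norm w * cplx_norm w'.
  rewrite -(@ler_pXn2r _ 2) ?nnegrE ?addr_ge0 ?mulr_ge0 ?cplx_norm_ge0//.
  rewrite exprMn !cplx_norm_sqr -subr_ge0.
  have := sqr_ge0 (`|w.1| * `|w'.2| - `|w.2| * `|w'.1|).
  by move: (`|w.1|) (`|w'.1|) (`|w.2|) (`|w'.2|) => a b c d; nra.
have m1 : `|w.1 + w'.1| ^+ 2 <= (`|w.1| + `|w'.1|) ^+ 2.
  by rewrite lerXn2r ?nnegrE// addr_ge0.
have m2 : `|w.2 + w'.2| ^+ 2 <= (`|w.2| + `|w'.2|) ^+ 2.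
  by rewrite lerXn2r ?nnegrE// addr_ge0.
rewrite (le_trans (lerD m1 m2))// !sqrrD.
move: CS; move: (`|w.1|) (`|w'.1|) (`|w.2|) (`|w'.2|) (cplx_norm w * _).
by move=> a b c d e; lra.
Qed.

Lemma geo_complete_cplx : geo_complete (@cplx_norm R (l2 R)).
Proof.
move=> y c yc.
have [l1 [C1 l1P]] : exists l C, forall k, `|(y k).1 - l| <= C / 2 ^+ k.
  apply: (geo_complete_l2 (y := fun k => (y k).1)) => k.
  exact: le_trans (cplx_norm_fst _) (yc k).
have [l2 [C2 l2P]] : exists l C, forall k, `|(y k).2 - l| <= C / 2 ^+ k.
  apply: (geo_complete_l2 (y := fun k => (y k).2)) => k.
  exact: le_trans (cplx_norm_snd _) (yc k).
exists (l1, l2), (C1 + C2) => k; rewrite (le_trans (cplx_norm_le_sum _))// mulrDl.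
by apply: lerD; [exact: l1P | exact: l2P].
Qed.

End cplx_norm_theory.

(** * Diagonal operators on their maximal domains *)

Section diagonal_operators.
Context {R : realType}.
Implicit Types (m : nat -> R) (u v : l2 R).

Definition diag_dom m : set (l2 R) :=
  [set v | (fun i => m i * v i : R^o) \in @square_summable R].

Definition diag_op m v := to_l2 (fun i => m i * v i).

Lemma diag_opE m v i : diag_dom m v -> diag_op m v i = m i * v i.
Proof. by move=> dv; rewrite to_l2E. Qed.

Lemma diag_domP m (a : R) u v :
  diag_dom m u -> diag_dom m v -> diag_dom m (a *: u + v).
Proof.
move=> du dv; rewrite /diag_dom /mkset.
rewrite (_ : (fun _ => _) = a *: (fun i => m i * u i : R^o) + (fun i => m i * v i : R^o)).
  by apply: rpredD => //; exact: rpredZ.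
by apply/funext => i; rewrite l2_addE l2_scaleE !fctE mulrDr mulrCA.
Qed.

Lemma diag_op_linear m (a : R) u v : diag_dom m u -> diag_dom m v ->
  diag_op m (a *: u + v) = a *: diag_op m u + diag_op m v.
Proof.
move=> du dv; apply: l2_eq => i; rewrite diag_opE; last exact: diag_domP.
by rewrite !l2_addE !l2_scaleE !diag_opE// mulrDr mulrCA.
Qed.

Lemma diag_dom_bounded m K v : (forall i, `|m i| <= K) -> diag_dom m v.
Proof.
move=> mK; apply: (@square_summable_le _ _ v K) => i.
by rewrite normrM ler_wpM2r.
Qed.

Lemma diag_op_norm m K v : (forall i, `|m i| <= K) -> `|diag_op m v| <= K * `|v|.
Proof.
move=> mK; apply: l2_norm_le_mul => [|i]; first exact: le_trans (mK 0%N).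
by rewrite diag_opE ?normrM ?ler_wpM2r//; exact: diag_dom_bounded mK.
Qed.

Lemma diag_dom_finite m v n : (forall i, (n <= i)%N -> v i = 0) -> diag_dom m v.
Proof.
move=> v0; apply: (@square_summable_bound _ _ (\sum_(i < n) (m i * v i) ^+ 2)) => N.
rewrite -!(big_mkord xpredT (fun i => (m i * v i) ^+ 2)).
have [Nn|nN] := leqP N n.
  rewrite [leRHS](big_cat_nat (leq0n N) Nn)/= lerDl.
  by apply: sumr_ge0 => i _; rewrite sqr_ge0.
rewrite (big_cat_nat (leq0n n) (ltnW nN))/= [X in _ + X]big_nat [X in _ + X]big1 ?addr0//.
by move=> i /andP[ni _]; rewrite v0// mulr0 expr0n.
Qed.

Lemma diag_op_sym m u v : diag_dom m u -> diag_dom m v ->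
  l2_dot (diag_op m u) v = l2_dot u (diag_op m v).
Proof.
move=> du dv; congr (limn (series _)); apply/funext => i.
by rewrite !diag_opE// [m i * u i]mulrC mulrA.
Qed.

Lemma diag_opC m m' v :
  diag_dom m v -> diag_dom m' v ->
  diag_dom m (diag_op m' v) -> diag_dom m' (diag_op m v) ->
  diag_op m (diag_op m' v) = diag_op m' (diag_op m v).
Proof.
move=> dv dv' dmv dmv'; apply: l2_eq => i; rewrite [LHS](diag_opE i dmv).
rewrite [RHS](diag_opE i dmv') [X in _ * X = _](diag_opE i dv').
by rewrite [X in _ = _ * X](diag_opE i dv) mulrCA.
Qed.

Lemma diag_dom0 m : diag_dom m 0.
Proof. exact: (@diag_dom_finite _ _ 0%N). Qed.

Definition l2_cut n v : l2 R := to_l2 (fun i => if (i < n)%N then v i else 0).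

Lemma l2_cutE n v i : l2_cut n v i = if (i < n)%N then v i else 0.
Proof.
rewrite to_l2E//; apply: (@square_summable_le _ _ v 1) => j.
by rewrite mul1r; case: ifP => // _; rewrite normr0.
Qed.

Lemma l2_cut_out n v i : (n <= i)%N -> l2_cut n v i = 0.
Proof. by rewrite l2_cutE ltnNge => ->. Qed.

(** Truncation is an orthogonal projection, so the squared error is the squared norm minus a partial
    sum of its series. *)
Lemma l2_cut_cvg v e : 0 < e -> exists n, `|v - l2_cut n v| < e.
Proof.
move=> e0.
have dotE n w : l2_dot (l2_cut n v) w = \sum_(i < n) v i * w i.
  rewrite (l2_dot_finite _ (l2_cut_out v)); apply: eq_bigr => i _.
  by rewrite l2_cutE ltn_ord.
have sumE n : `|v - l2_cut n v| ^+ 2 = `|v| ^+ 2 - \sum_(i < n) v i * v i.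
  rewrite !l2_norm_sqr l2_dotDl -scaleN1r l2_dotZl !l2_dotDr !l2_dotZr.
  rewrite [l2_dot v (l2_cut _ _)]l2_dotC !dotE.
  have -> : \sum_(i < n) v i * l2_cut n v i = \sum_(i < n) v i * v i.
    by apply: eq_bigr => i _; rewrite l2_cutE ltn_ord.
  by ring.
have : series (fun n => v n * v n : R^o) n @[n --> \oo] --> `|v| ^+ 2.
  by rewrite l2_norm_sqr; exact: l2_mul_cvg (l2P v) (l2P v).
move=> /cvgrPdist_lt /(_ _ (exprn_gt0 2 e0)) [n _ /(_ n (leqnn n))].
rewrite seriesEord/= -sumE ger0_norm ?sqr_ge0// => h; exists n.
by rewrite -(@ltr_pXn2r _ 2) ?nnegrE// ltW.
Qed.

Lemma diag_dom_dense m : dense (diag_dom m).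
Proof.
move=> O [v Ov] oO; have /nbhs_ballP[e /= e0 eO] := open_nbhs_nbhs (conj oO Ov).
have [n ve] := l2_cut_cvg v e0.
exists (l2_cut n v); split; last exact: (diag_dom_finite _ (@l2_cut_out n v)).
by apply: eO; rewrite -ball_normE.
Qed.

End diagonal_operators.

(** * Operators approximated in norm by orthogonal conjugates of a diagonal operator *)

Section approximately_diagonal.
Context {R : realType} (lam : nat -> R).
Implicit Types u v w : l2 R.

(** Preserving the domain in both directions gives the conjugate [U D U'] the same domain as the
    diagonal operator [D]. *)
Record diag_isometry (U U' : l2 R -> l2 R) : Prop := DiagIsometry {
  iso_linear : forall (a : R) u v, U (a *: u + v) = a *: U u + U v ;
  iso_inv_linear : forall (a : R) u v, U' (a *: u + v) = a *: U' u + U' v ;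
  isoK : cancel U U' ;
  iso_invK : cancel U' U ;
  iso_norm : forall v, `|U v| = `|v| ;
  iso_dom : forall v, diag_dom lam v -> diag_dom lam (U v) ;
  iso_inv_dom : forall v, diag_dom lam v -> diag_dom lam (U' v) }.

Definition approximately_diagonal (T : partial_op (l2 R)) :=
  dom T = diag_dom lam /\
  forall delta, 0 < delta -> exists U U', diag_isometry U U' /\
    forall w, diag_dom lam w ->
      `|T w - U (diag_op lam (U' w))| <= delta * `|w|.

Lemma iso0 U U' : diag_isometry U U' -> U 0 = 0.
Proof. by move=> UU; apply/eqP; rewrite -normr_le0 (iso_norm UU) normr0. Qed.

Lemma isoB U U' u v : diag_isometry U U' -> U (u - v) = U u - U v.
Proof.
by move=> UU; rewrite addrC -scaleN1r (iso_linear UU) scaleN1r addrC.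
Qed.

Lemma isoZ U U' (a : R) u : diag_isometry U U' -> U (a *: u) = a *: U u.
Proof.
by move=> UU; rewrite -[a *: u]addr0 (iso_linear UU) (iso0 UU) addr0.
Qed.

Lemma iso_inv_norm U U' v : diag_isometry U U' -> `|U' v| = `|v|.
Proof. by move=> UU; rewrite -(iso_norm UU) (iso_invK UU). Qed.

Lemma diag_isometry_inv U U' : diag_isometry U U' -> diag_isometry U' U.
Proof. by move=> UU; case: (UU) => *; split => // v; exact: iso_inv_norm. Qed.

Lemma iso_dot U U' u v : diag_isometry U U' -> l2_dot (U u) (U v) = l2_dot u v.
Proof.
move=> UU; have := iso_norm UU (1 *: u + v).
move=> /(congr1 (fun x => x ^+ 2)); rewrite (iso_linear UU) !scale1r !l2_norm_sqr.
rewrite !l2_dotDl !l2_dotDr -!l2_norm_sqr !(iso_norm UU).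
by rewrite (l2_dotC (U v)) (l2_dotC v); lra.
Qed.

Lemma iso_inv_dot U U' u v : diag_isometry U U' ->
  l2_dot (U u) v = l2_dot u (U' v).
Proof. by move=> UU; rewrite -[RHS](iso_dot _ _ UU) (iso_invK UU). Qed.

Lemma le0_small (x c : R) : (forall e, 0 < e -> x <= c * e) -> x <= 0.
Proof.
move=> xc; rewrite leNgt; apply/negP => x0.
have d0 : 0 < x / (`|c| + 1) / 2 by rewrite !divr_gt0// ltr_wpDl.
have := xc _ d0; apply/negP; rewrite -ltNge.
apply: (@le_lt_trans _ _ ((`|c| + 1) * (x / (`|c| + 1) / 2))).
  by rewrite ler_pM2r// (le_trans (ler_norm c))// lerDl.
by rewrite mulrA mulrCA divff ?mulr1 ?ltr_pdivrMr ?ltr_pMr ?ltr1n// gt_eqF// ltr_wpDl.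
Qed.

Variable T : partial_op (l2 R).
Hypothesis T_approx : approximately_diagonal T.

Let domT : dom T = diag_dom lam := T_approx.1.

(** Each conjugate is symmetric, and replacing [T] by it costs at most [2 * e * |u| * |v|] for
    arbitrary [e]. *)
Lemma approx_diag_sym u v : diag_dom lam u -> diag_dom lam v ->
  l2_dot (T u) v = l2_dot u (T v).
Proof.
move=> du dv; apply/eqP; rewrite -subr_eq0 -normr_le0.
apply: (@le0_small _ (2 * (`|u| * `|v|))) => e e0.
have [U [U' [UU TU]]] := T_approx.2 e e0.
pose A w := U (diag_op lam (U' w)).
have Asym : l2_dot (A u) v = l2_dot u (A v).
  rewrite /A (iso_inv_dot _ _ UU) diag_op_sym; try exact: (iso_inv_dom UU).
  by rewrite -[in RHS](iso_invK UU u) (iso_dot _ _ UU).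
have -> : l2_dot (T u) v - l2_dot u (T v) =
    l2_dot (T u - A u) v - l2_dot u (T v - A v).
  by rewrite l2_dotDl l2_dotNl l2_dotDr l2_dotNr Asym; ring.
rewrite (le_trans (ler_normB _ _))//.
have h1 := le_trans (l2_dot_le (T u - A u) v) (ler_wpM2r (normr_ge0 v) (TU u du)).
have h2 := le_trans (l2_dot_le u (T v - A v)) (ler_wpM2l (normr_ge0 u) (TU v dv)).
rewrite (le_trans (lerD h1 h2))//.
by lra.
Qed.

(** One conjugate at distance 1 is enough. The functional is tested on [U (x N)], where [x N] is [D]
    applied to a truncation of [U' v]: this bounds [|x N| ^ 2] by [M' * |x N|], hence the partial
    sums of the squares of [lam i * U' v i] uniformly. *)
Lemma approx_diag_adjoint_dom v : adjoint_dom T v -> diag_dom lam v.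
Proof.
move=> [M vM]; have [U [U' [UU TU]]] := T_approx.2 1 ltr01.
suff : diag_dom lam (U' v) by move=> /(iso_dom UU); rewrite (iso_invK UU).
have dcut N : diag_dom lam (l2_cut N (U' v)) :=
  diag_dom_finite _ (@l2_cut_out _ N (U' v)).
pose x N := diag_op lam (l2_cut N (U' v)).
have xE N i : x N i = if (i < N)%N then lam i * U' v i else 0.
  by rewrite diag_opE// l2_cutE; case: ifP => // _; rewrite mulr0.
have x0 N i : (N <= i)%N -> x N i = 0 by rewrite xE ltnNge => ->.
have dx N : diag_dom lam (x N) := diag_dom_finite _ (x0 N).
have xx N : `|x N| ^+ 2 = \sum_(i < N) (lam i * U' v i) ^+ 2.
  rewrite l2_norm_sqr (l2_dot_finite _ (x0 N)); apply: eq_bigr => i _.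
  by rewrite xE ltn_ord expr2.
have xdot N : l2_dot (U' v) (diag_op lam (x N)) = `|x N| ^+ 2.
  rewrite l2_dotC (@l2_dot_finite _ _ _ N) => [|i Ni].
    rewrite xx; apply: eq_bigr => i _.
    by rewrite diag_opE// xE ltn_ord expr2; ring.
  by rewrite diag_opE// x0// mulr0.
(* [|M|] comes from the functional, [|v|] from replacing [T] by the conjugate at distance 1. *)
pose M' := `|M| + `|v|.
have xM N : `|x N| <= M'.
  have : `|x N| ^+ 2 <= M' * `|x N|.
    rewrite -xdot l2_dotC -(iso_inv_dot _ _ UU).
    have -> : l2_dot (U (diag_op lam (x N))) v =
        l2_dot v (T (U (x N))) - l2_dot v (T (U (x N)) - U (diag_op lam (U' (U (x N))))).
      by rewrite l2_dotDr l2_dotNr (isoK UU) l2_dotC; ring.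
    rewrite (le_trans (ler_norm _))// (le_trans (ler_normB _ _))// mulrDl.
    have dUx := iso_dom UU (dx N).
    apply: lerD.
      rewrite -(iso_norm UU (x N)) (le_trans (vM _ _)) ?domT//.
      by rewrite ler_wpM2r// ler_norm.
    rewrite (le_trans (l2_dot_le _ _))// ler_wpM2l//.
    by rewrite (le_trans (TU _ dUx))// mul1r (iso_norm UU).
  have [->|xn0] := eqVneq `|x N| 0; first by rewrite addr_ge0.
  by rewrite expr2 ler_pM2r// lt_def xn0 normr_ge0.
apply: (@square_summable_bound _ _ (M' ^+ 2)) => N.
by rewrite -xx lerXn2r ?nnegrE// addr_ge0.
Qed.

Lemma approx_diag_self_adjoint : self_adjoint T.
Proof.
split=> [|v dv].
  rewrite domT; apply/seteqP; split => [v dv|]; last exact: approx_diag_adjoint_dom.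
  exists `|T v| => w; rewrite domT => dw.
  by rewrite -approx_diag_sym//; exact: l2_dot_le.
(* By symmetry [T v] satisfies the defining property of the adjoint vector. Testing against basis
   vectors, which lie in the domain, determines every coordinate. *)
rewrite domT in dv; apply: xget_unique => [w|u uP].
  by rewrite domT => dw /=; rewrite approx_diag_sym.
apply: l2_eq => i; rewrite -!(l2_dot_basis _ i) !(l2_dotC (l2_basis R i)).
have di : diag_dom lam (l2_basis R i).
  by apply: (@diag_dom_finite _ _ _ i.+1) => j ij; rewrite l2_basisE gtn_eqF.
by rewrite uP ?domT// approx_diag_sym.
Qed.

Lemma approx_diag_dense : densely_defined T.
Proof. by rewrite /densely_defined domT; exact: diag_dom_dense. Qed.

Lemma approx_diag_approx_point (x : R) :
  (forall e, 0 < e -> exists i, `|lam i - x| < e) ->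
  approx_point_value (@Num.norm R (l2 R)) T x.
Proof.
move=> xlam.
have /choice[v vP] : forall n, exists v,
    [/\ dom T v, `|v| = 1 & `|T v - x *: v| <= 2 / 2 ^+ n].
  move=> n; have e0 : 0 < (2 ^+ n : R)^-1 by rewrite invr_gt0 exprn_gt0.
  have [U [U' [UU TU]]] := T_approx.2 _ e0.
  have [i ix] := xlam _ e0.
  have di : diag_dom lam (l2_basis R i).
    by apply: (@diag_dom_finite _ _ _ i.+1) => j ij; rewrite l2_basisE gtn_eqF.
  (* An exact eigenvector of the conjugate, with eigenvalue [lam i]. One error [2 ^- n] comes from
     the conjugation, another from [lam i - x]. *)
  exists (U (l2_basis R i)); split.
  - by rewrite domT; exact: (iso_dom UU).
  - by rewrite (iso_norm UU) l2_norm_basis.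
  - rewrite -(subrKA (U (diag_op lam (U' (U (l2_basis R i)))))).
    have h := TU _ (iso_dom UU di).
    rewrite (le_trans (ler_normD _ _))// [leRHS]mulrDl mul1r lerD//.
      by rewrite (le_trans h)// (iso_norm UU) l2_norm_basis mulr1.
    rewrite (isoK UU) -(isoZ _ _ UU) -(isoB _ _ UU) (iso_norm UU).
    rewrite (_ : _ - _ = (lam i - x) *: l2_basis R i).
      by rewrite normrZ l2_norm_basis mulr1 ltW.
    apply: l2_eq => j; rewrite l2_addE l2_oppE !l2_scaleE diag_opE// l2_basisE.
    by case: eqP => [->|_]; rewrite ?mulr1 ?mulr0 ?subr0.
exists v; split => [n|n|]; try by case: (vP n).
apply/cvgrPdist_lt => e e0; have [N NP] := geo_small 2 e0.
near=> n; rewrite sub0r normrN normr_id; have [_ _ h] := vP n.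
by rewrite (le_lt_trans h)// NP//; near: n; exact: nbhs_infty_ge.
Unshelve. all: by end_near. Qed.

(** The conjugate of [(D - x)^-1] has norm at most [1 / eta], and [T] is taken within [eta / 2] of
    its conjugate, so both errors of the approximate inverse are at most one half. *)
Lemma approx_diag_resolvent_real (x : R) eta :
  0 < eta -> (forall i, eta <= `|lam i - x|) ->
  resolvent_value (@Num.norm R (l2 R)) T x.
Proof.
move=> eta0 far.
have e20 : 0 < eta / 2 by rewrite divr_gt0.
have [U [U' [UU TU]]] := T_approx.2 _ e20.
have lx i : lam i - x != 0.
  by rewrite -normr_gt0; exact: lt_le_trans (far i).
pose m i := (lam i - x)^-1.
have mK i : `|m i| <= eta^-1.
  by rewrite normfV lef_pV2 ?posrE// normr_gt0.
have dm v : diag_dom m v := diag_dom_bounded v mK.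
have dlm v : diag_dom lam (diag_op m v).
  apply: (@square_summable_le _ _ v (1 + `|x| / eta)) => i.
  rewrite diag_opE// mulrA normrM ler_wpM2r//.
  (* The product [lam i * m i] is therefore bounded, so multiplication by [m] maps into the domain
     of [D]. *)
  rewrite (_ : lam i * m i = 1 + x * m i); last by rewrite /m; field; exact: lx.
  by rewrite (le_trans (ler_normD _ _))// normr1 lerD2l normrM ler_wpM2l.
pose S v := U (diag_op m (U' v)).
have SM v : `|S v| <= eta^-1 * `|v|.
  by rewrite (iso_norm UU) -(iso_inv_norm v UU); exact: diag_op_norm.
apply: (@resolvent_of_approximate_inverse _ _ _ _ _ _ _ _ _ T x S eta^-1) => //.
- exact: normr0_eq0.
- exact: normrN.
- exact: ler_normD.
- exact: geo_complete_l2.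
- move=> a u v; rewrite /S (iso_inv_linear UU) diag_op_linear//.
  exact: (iso_linear UU).
- by move=> v; rewrite domT; apply: (iso_dom UU).
- move=> v; have := TU (S v) (iso_dom UU (dlm _)).
  have -> : U (diag_op lam (U' (S v))) = x *: S v + v.
    rewrite /S (isoK UU) -[X in _ = _ + X](iso_invK UU) -(iso_linear UU); congr U.
    apply: l2_eq => i; rewrite l2_addE l2_scaleE !diag_opE// /m; field; exact: lx.
  rewrite opprD addrA => /le_trans; apply.
  have -> : `|v| / 2 = eta / 2 * (eta^-1 * `|v|) by field; rewrite gt_eqF.
  by rewrite ler_wpM2l// ltW// divr_gt0.
- move=> w; rewrite domT => dw.
  have SB u v : S (u - v) = S u - S v.
    rewrite /S (isoB _ _ (diag_isometry_inv UU)) addrC -scaleN1r diag_op_linear//.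
    by rewrite (iso_linear UU) scaleN1r addrC.
  have Sinv : S (U (diag_op lam (U' w)) - x *: w) = w.
    rewrite /S (isoB _ _ (diag_isometry_inv UU)) (isoZ _ _ (diag_isometry_inv UU)) (isoK UU).
    rewrite -[RHS](iso_invK UU); congr U; apply: l2_eq => i.
    rewrite diag_opE// l2_addE l2_oppE l2_scaleE diag_opE; last exact: (iso_inv_dom UU).
    by rewrite /m; field; exact: lx.
  rewrite -[X in _ - X]Sinv -SB opprB addrA subrK.
  rewrite (le_trans (SM _))// (le_trans (ler_wpM2l _ (TU w dw))) ?invr_ge0 ?(ltW eta0)//.
  by rewrite le_eqVlt; apply/orP; left; apply/eqP; field; rewrite gt_eqF.
Qed.


Lemma cplx_scaleE (a b : R) (w : complexification (l2 R)) :
  (a +i* b)%C *: w = (a *: w.1 - b *: w.2, a *: w.2 + b *: w.1).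
Proof. by []. Qed.

(** [P] and [Q] stand for the real and imaginary parts of the resolvent of [A] at [a + i b]: the
    identities for [A (P v)] and [A (Q v)] are the two parts of [(A - a - i b)(P + i Q) = 1]. The
    complex operator [P + i Q] is an approximate inverse for [T]. *)
Lemma resolvent_cplx_of_pair (a b kappa delta : R) (A P Q : l2 R -> l2 R) :
  0 <= kappa -> 0 <= delta -> delta * (4 * kappa) = 2^-1 ->
  (forall (c : R) u v, P (c *: u + v) = c *: P u + P v) ->
  (forall (c : R) u v, Q (c *: u + v) = c *: Q u + Q v) ->
  (forall v, `|P v| <= kappa * `|v|) -> (forall v, `|Q v| <= kappa * `|v|) ->
  (forall v, dom T (P v)) -> (forall v, dom T (Q v)) ->
  (forall (c : R) u v, dom T u -> dom T v -> A (c *: u + v) = c *: A u + A v) ->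
  (forall v, A (P v) = a *: P v - b *: Q v + v) ->
  (forall v, A (Q v) = a *: Q v + b *: P v) ->
  (forall v, dom T v -> P (A v) = A (P v)) ->
  (forall v, dom T v -> Q (A v) = A (Q v)) ->
  (forall w, dom T w -> `|T w - A w| <= delta * `|w|) ->
  resolvent_value (@cplx_norm R (l2 R)) (cplx_op T) (a +i* b)%C.
Proof.
move=> k0 d0 kd Plin Qlin PM QM dP dQ Alin AP AQ PA QA TA.
have PD u v : P (u + v) = P u + P v by rewrite -[u]scale1r Plin !scale1r.
have QD u v : Q (u + v) = Q u + Q v by rewrite -[u]scale1r Qlin !scale1r.
have P0 : P 0 = 0 by apply/eqP; rewrite -normr_le0 (le_trans (PM 0))// normr0 mulr0.
have Q0 : Q 0 = 0 by apply/eqP; rewrite -normr_le0 (le_trans (QM 0))// normr0 mulr0.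
have PZ (c : R) u : P (c *: u) = c *: P u by rewrite -[c *: u]addr0 Plin P0 addr0.
have QZ (c : R) u : Q (c *: u) = c *: Q u by rewrite -[c *: u]addr0 Qlin Q0 addr0.
have PN u : P (- u) = - P u by rewrite -scaleN1r PZ scaleN1r.
have QN u : Q (- u) = - Q u by rewrite -scaleN1r QZ scaleN1r.
have AD u v : dom T u -> dom T v -> A (u + v) = A u + A v.
  by move=> du dv; rewrite -[u]scale1r Alin// !scale1r.
have AB u v : dom T u -> dom T v -> A (u - v) = A u - A v.
  by move=> du dv; rewrite addrC -scaleN1r Alin// scaleN1r addrC.
have dB u v : dom T u -> dom T v -> dom T (u - v).
  by move=> du dv; rewrite addrC -scaleN1r; exact: domP.
have dD u v : dom T u -> dom T v -> dom T (u + v).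
  by move=> du dv; rewrite -[u]scale1r; exact: domP.
pose S (w : complexification (l2 R)) : complexification (l2 R) :=
  (P w.1 - Q w.2, P w.2 + Q w.1).
(* A crude bound: four terms, each at most [kappa * cplx_norm w]. *)
have SM (w : complexification (l2 R)) : cplx_norm (S w) <= 4 * kappa * cplx_norm w.
  have h1 := ler_wpM2l k0 (cplx_norm_fst w).
  have h2 := ler_wpM2l k0 (cplx_norm_snd w).
  rewrite (_ : 4 * kappa * _ = (kappa * cplx_norm w + kappa * cplx_norm w) +
    (kappa * cplx_norm w + kappa * cplx_norm w)); last by ring.
  rewrite (le_trans (cplx_norm_le_sum _))// lerD//.
    rewrite (le_trans (ler_normB _ _))// lerD//.
      exact: le_trans (PM _) h1.
    exact: le_trans (QM _) h2.
  rewrite (le_trans (ler_normD _ _))// lerD//.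
    exact: le_trans (PM _) h2.
  exact: le_trans (QM _) h1.
have Edelta (w : complexification (l2 R)) : dom T w.1 -> dom T w.2 ->
    cplx_norm ((T w.1 - A w.1, T w.2 - A w.2) : complexification (l2 R))
      <= delta * cplx_norm w.
  by move=> d1 d2; apply: cplx_norm_le_mul => //; exact: TA.
have k4 : 0 <= 4 * kappa by rewrite mulr_ge0.
apply: (@resolvent_of_approximate_inverse _ _ _ _ _ _ _ _ _ _ _ S (4 * kappa)).
- exact: cplx_norm_ge0.
- exact: cplx_norm_eq0.
- exact: cplx_normN.
- exact: cplx_normD.
- exact: geo_complete_cplx.
- case=> c d u v; rewrite !cplx_scaleE /S /=.
  congr (_, _); rewrite !(PD, QD, PN, QN, PZ, QZ); apply: l2_eq => i.
    by rewrite !(l2_addE, l2_scaleE, l2_oppE); ring.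
  by rewrite !(l2_addE, l2_scaleE, l2_oppE); ring.
- by move=> w; split; [exact: dB | exact: dD].
- exact: SM.
- move=> w; set Sw := S w.
  have dS1 : dom T Sw.1 by exact: dB.
  have dS2 : dom T Sw.2 by exact: dD.
  have -> : cplx_op T Sw - (a +i* b)%C *: Sw - w = (T Sw.1 - A Sw.1, T Sw.2 - A Sw.2).
    rewrite cplx_scaleE; congr (_, _) => /=.
      rewrite AB// AP AQ; apply: l2_eq => i.
      by rewrite !(l2_addE, l2_scaleE, l2_oppE); ring.
    rewrite AD// AP AQ; apply: l2_eq => i.
    by rewrite !(l2_addE, l2_scaleE, l2_oppE); ring.
  apply: (le_trans (Edelta _ dS1 dS2)); apply: (le_trans (ler_wpM2l d0 (SM w))).
  by rewrite mulrA kd mulrC.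
- move=> w [/= d1 d2].
  pose E := (T w.1 - A w.1, T w.2 - A w.2) : complexification (l2 R).
  have -> : S (cplx_op T w - (a +i* b)%C *: w) - w = S E.
    rewrite cplx_scaleE /S /E /=; congr (_, _) => /=.
      rewrite !(PD, QD, PN, QN, PZ, QZ) !PA// !QA// !AP !AQ; apply: l2_eq => i.
      by rewrite !(l2_addE, l2_scaleE, l2_oppE); ring.
    rewrite !(PD, QD, PN, QN, PZ, QZ) !PA// !QA// !AP !AQ; apply: l2_eq => i.
    by rewrite !(l2_addE, l2_scaleE, l2_oppE); ring.
  apply: (le_trans (SM E)).
  apply: (le_trans (ler_wpM2l k4 (Edelta _ d1 d2))).
  by rewrite mulrA [_ * delta]mulrC kd mulrC.
Qed.

Lemma approx_diag_resolvent_cplx (a b : R) : b != 0 ->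
  resolvent_value (@cplx_norm R (l2 R)) (cplx_op T) (a +i* b)%C.
Proof.
move=> b0; have nb0 : 0 < `|b| by rewrite normr_gt0.
have e0 : 0 < `|b| / 8 by rewrite divr_gt0.
have [U [U' [UU TU]]] := T_approx.2 _ e0.
have VV := diag_isometry_inv UU.
pose rho i := (lam i - a) ^+ 2 + b ^+ 2.
have rho0 i : 0 < rho i by rewrite ltr_wpDl ?sqr_ge0// exprn_even_gt0.
have rhoN i : rho i != 0 by rewrite gt_eqF.
(* Real and imaginary parts of [1 / (lam i - a - i b)]. Both are at most [1 / |b|] in absolute
   value, which matches the error [|b| / 8] chosen above. *)
pose p i := (lam i - a) / rho i; pose r i := b / rho i.
have bd x i : x ^+ 2 + b ^+ 2 = rho i -> `|x / rho i| <= `|b|^-1 /\ `|r i| <= `|b|^-1.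
  move=> xr; have xb : `|x| * `|b| <= rho i /\ `|b| * `|b| <= rho i.
    rewrite -xr -(real_normK (num_real x)) -(real_normK (num_real b)).
    have := normr_ge0 x; have := normr_ge0 b.
    by move: (`|x|) (`|b|) => y z z0 y0; split; nra.
  rewrite !normrM !normfV (gtr0_norm (rho0 i)) !ler_pdivrMr// mulrC ler_pdivlMr//.
  by rewrite ler_pdivlMr.
have pK i : `|p i| <= `|b|^-1 by case: (bd (lam i - a) i).
have rK i : `|r i| <= `|b|^-1 by case: (bd (lam i - a) i).
have dp v : diag_dom p v := diag_dom_bounded v pK.
have dr v : diag_dom r v := diag_dom_bounded v rK.
have pr1 i : (lam i - a) * p i + b * r i = 1.
  by rewrite /p /r !mulrA -mulrDl -!expr2 -/(rho i) divff.
have pr2 i : (lam i - a) * r i = b * p i by rewrite /p /r; ring.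
have dlr v : diag_dom lam (diag_op r v).
  apply: (@square_summable_le _ _ v (`|b| * `|b|^-1 + `|a| * `|b|^-1)) => i.
  rewrite diag_opE// mulrA normrM ler_wpM2r//.
  rewrite (_ : lam i * r i = b * p i + a * r i); last first.
    by rewrite -pr2; ring.
  rewrite (le_trans (ler_normD _ _))// (normrM b) (normrM a).
  by apply: lerD; rewrite ler_wpM2l.
have dlp v : diag_dom lam (diag_op p v).
  apply: (@square_summable_le _ _ v (1 + `|b| * `|b|^-1 + `|a| * `|b|^-1)) => i.
  rewrite diag_opE// mulrA normrM ler_wpM2r//.
  rewrite (_ : lam i * p i = 1 - b * r i + a * p i); last first.
    by rewrite -(pr1 i); ring.
  rewrite (le_trans (ler_normD _ _))// lerD//.
    by rewrite (le_trans (ler_normB _ _))// normr1 lerD2l (normrM b) ler_wpM2l.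
  by rewrite (normrM a) ler_wpM2l.
pose P v := U (diag_op p (U' v)); pose Q v := U (diag_op r (U' v)).
have Plin (c : R) u v : P (c *: u + v) = c *: P u + P v.
  by rewrite /P (iso_inv_linear UU) diag_op_linear// (iso_linear UU).
have Qlin (c : R) u v : Q (c *: u + v) = c *: Q u + Q v.
  by rewrite /Q (iso_inv_linear UU) diag_op_linear// (iso_linear UU).
have dlP v : diag_dom lam (P v) by exact: (iso_dom UU).
have dlQ v : diag_dom lam (Q v) by exact: (iso_dom UU).
have PM v : `|P v| <= `|b|^-1 * `|v|.
  by rewrite (iso_norm UU) -(iso_inv_norm v UU); exact: diag_op_norm.
have QM v : `|Q v| <= `|b|^-1 * `|v|.
  by rewrite (iso_norm UU) -(iso_inv_norm v UU); exact: diag_op_norm.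
pose A v := U (diag_op lam (U' v)).
have Alin (c : R) u v : diag_dom lam u -> diag_dom lam v ->
    A (c *: u + v) = c *: A u + A v.
  move=> du dv; rewrite /A (iso_inv_linear UU) diag_op_linear.
  - exact: (iso_linear UU).
  - exact: (iso_inv_dom UU).
  - exact: (iso_inv_dom UU).
have AP v : A (P v) = a *: P v - b *: Q v + v.
  rewrite /A /P /Q (isoK UU) -[X in _ = _ + X](iso_invK UU).
  rewrite -!(isoZ _ _ UU) -(isoB _ _ UU) -[X in _ = X + _]scale1r -(iso_linear UU).
  congr U; apply: l2_eq => i.
  rewrite !(l2_addE, l2_scaleE, l2_oppE, diag_opE)//.
  by rewrite mul1r -[X in _ = _ + X]mul1r -(pr1 i); ring.
have AQ v : A (Q v) = a *: Q v + b *: P v.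
  rewrite /A /P /Q (isoK UU) -!(isoZ _ _ UU) -[X in _ = X + _]scale1r -(iso_linear UU).
  congr U; apply: l2_eq => i.
  rewrite !(l2_addE, l2_scaleE, l2_oppE, diag_opE)//.
  by rewrite [X in _ = _ + X]mulrA -pr2; ring.
have PA v : diag_dom lam v -> P (A v) = A (P v).
  move=> dv; have dv' := iso_inv_dom UU dv.
  rewrite /P /A !(isoK UU).
  by rewrite (diag_opC (dp _) dv' (dp _) (dlp _)).
have QA v : diag_dom lam v -> Q (A v) = A (Q v).
  move=> dv; have dv' := iso_inv_dom UU dv.
  rewrite /Q /A !(isoK UU).
  by rewrite (diag_opC (dr _) dv' (dr _) (dlr _)).
have b1 : 0 <= `|b|^-1 by rewrite invr_ge0.
have kd : `|b| / 8 * (4 * `|b|^-1) = 2^-1 by field; rewrite gt_eqF.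
rewrite -domT in Alin dlP dlQ PA QA TU.
exact: (resolvent_cplx_of_pair b1 (ltW e0) kd Plin Qlin PM QM dlP dlQ Alin AP AQ PA QA TU).
Qed.

End approximately_diagonal.

(** A bounded inverse would send [(T - lambda) (v n)], which tends to 0, to the unit vectors
    [v n]. *)
Lemma approx_point_not_resolvent (R : realType) (K : pzRingType) (V : lmodType K)
    (nrm : V -> R) (T : partial_op V) (lambda : K) :
  approx_point_value nrm T lambda -> ~ resolvent_value nrm T lambda.
Proof.
move=> [v [dv v1 v0]] [S [[M SM] _ ST]].
have M1 n : 1 <= M * nrm (T (v n) - lambda *: v n).
  by rewrite -(v1 n) -{1}(ST _ (dv n)).
have : M * nrm (T (v n) - lambda *: v n) @[n --> \oo] --> M * 0.
  by apply: cvgM => //; exact: cvg_cst.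
rewrite mulr0 => /cvgrPdist_lt /(_ _ ltr01) [N _ /(_ N (leqnn N))] /=.
by rewrite sub0r normrN ltNge (le_trans (M1 N))// ler_norm.
Qed.

(** A cycle of inclusions: [Lambda] in the approximate point spectrum, that in the spectrum, and the
    spectrum in [Lambda]. Closedness keeps a real point outside [Lambda] at positive distance from
    all [lam i]. *)
Lemma approx_diag_spectrum (R : realType) (lam : nat -> R) (Lambda : set R)
    (T : partial_op (l2 R)) :
  approximately_diagonal lam T -> closed Lambda -> (forall i, Lambda (lam i)) ->
  (forall x, Lambda x -> forall e, 0 < e -> exists i, `|lam i - x| < e) ->
  spectrum T = approx_point_spectrum T /\
  spectrum T = [set (x%:C)%C | x in Lambda].
Proof.
move=> Tlam cL lamL Ldense.
have LA : [set (x%:C)%C | x in Lambda] `<=` approx_point_spectrum T.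
  move=> _ [x Lx <-]; rewrite /approx_point_spectrum /= eqxx.
  exact: (approx_diag_approx_point Tlam (Ldense x Lx)).
have AS : approx_point_spectrum T `<=` spectrum T.
  move=> z; rewrite /approx_point_spectrum /spectrum /=.
  by case: ifP => _; exact: approx_point_not_resolvent.
have SL : spectrum T `<=` [set (x%:C)%C | x in Lambda].
  case=> a b; rewrite /spectrum /=; have [->|b0] := eqVneq b 0; last first.
    by move=> h; exfalso; apply: h; exact: (approx_diag_resolvent_cplx Tlam).
  move=> h; exists a => //; apply: contrapT => nLa; apply: h.
  have : (~` Lambda) a by [].
  have oL : open (~` Lambda) by exact: closed_openC.
  move=> La; have /nbhs_ballP[e /= e0 eL] := open_nbhs_nbhs (conj oL La).
  apply: (approx_diag_resolvent_real Tlam e0) => i; rewrite leNgt; apply/negP => lt.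
  by apply: (eL (lam i)) => //; rewrite -ball_normE /= distrC.
split; apply/seteqP; split => //.
- by move=> z /SL /LA.
- by move=> z /LA /AS.
Qed.

(** * An injective dense sequence in an infinite set of reals *)

Section dense_sequence.
Context {R : realType}.

Lemma injective_dense_sequence (Lambda : set R) : infinite_set Lambda ->
  exists lam : nat -> R, [/\ injective lam, forall i, Lambda (lam i) &
    forall x, Lambda x -> forall e, 0 < e -> exists i, `|lam i - x| < e].
Proof.
move=> Linf; have [x0 Lx0] := infinite_setN0 Linf.
pose near_set (p : rat * nat) : set R :=
  [set x | Lambda x /\ `|x - ratr p.1| < p.2.+1%:R^-1].
(* For each rational and each tolerance, a point of [Lambda] that close to the rational, or [x0] if
   there is none. The countable range is dense in [Lambda]. *)
pose f (p : rat * nat) := xget x0 (near_set p).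
have fL p : Lambda (f p).
  by rewrite /f; case: xgetP => [y -> []|].
have fdense x : Lambda x -> forall e, 0 < e -> exists p, `|f p - x| < e.
  move=> Lx e e0; pose k := Num.bound (2 / e).
  have ke : 2 / e < k.+1%:R.
    rewrite (lt_trans (archi_boundP _)) ?divr_ge0 ?(ltW e0)//.
    by rewrite ltr_nat.
  have k0 : 0 < k.+1%:R^-1 :> R by rewrite invr_gt0.
  have [|q] := @rat_in_itvoo R (x - k.+1%:R^-1) (x + k.+1%:R^-1).
    by rewrite ltrD2l; apply: lt_trans k0; rewrite oppr_lt0.
  rewrite in_itv/= => /andP[q1 q2].
  have xq : near_set (q, k) x.
    by split => //=; rewrite ltr_distl ltrBlDr q2 -ltrBlDr q1.
  exists (q, k); have [_] : near_set (q, k) (f (q, k)) by exact: (xgetI x0 xq).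
  case: xq => _ /= h1 h2; rewrite -(subrKA (ratr q)).
  rewrite (le_lt_trans (ler_normD _ _))// [`|ratr q - x|]distrC.
  apply: (lt_trans (ltrD h2 h1)).
  suff : 2 * k.+1%:R^-1 < e by move: (k.+1%:R^-1) => z; lra.
  by rewrite ltr_pdivrMr ?ltr0Sn// mulrC -ltr_pdivrMr.
pose S := range f.
have Scount : countable S.
  by apply: (sub_countable (card_image_le _ _)); exact: countableP.
(* A finite dense subset would be closed, hence contain [Lambda]. *)
have Sinf : infinite_set S.
  move=> Sfin; apply: Linf; apply: sub_finite_set (Sfin).
  have /accessible_finite_set_closed Rfin : accessible_space R.
    exact/hausdorff_accessible/norm_hausdorff.
  have Scl : closed S by exact: Rfin.
  move=> x Lx; apply: Scl => B /nbhs_ballP[e /= e0 eB].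
  have [p pe] := fdense x Lx e e0.
  by exists (f p); split; [exists p | apply: eB; rewrite -ball_normE /= distrC].
have /card_set_bijP[h [hS hinj hsurj]] : ([set: nat] #= S)%card.
  by rewrite card_eq_le; apply/andP; split; [exact/infiniteP | exact: Scount].
exists h; split.
- by move=> i j; apply: hinj; rewrite inE.
- by move=> i; have [p _ <-] := hS i I; exact: fL.
- move=> x Lx e e0; have [p pe] := fdense x Lx e e0.
  by have [|i _ hi] := hsurj (f p); [exists p | exists i; rewrite hi].
Qed.

End dense_sequence.

(** * Orthogonal blocks acting on the first coordinates *)

Section block_isometry.
Context {R : realType}.

Definition block_fun n (q : 'M[R]_n) (v : nat -> R) (i : nat) : R :=
  if insub i : option 'I_n is Some k then \sum_j q k j * v j else v i.

Lemma block_fun_lt n (q : 'M[R]_n) v (k : 'I_n) :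
  block_fun q v k = \sum_j q k j * v j.
Proof. by rewrite /block_fun valK. Qed.

Lemma block_fun_ge n (q : 'M[R]_n) v i : (n <= i)%N -> block_fun q v i = v i.
Proof. by move=> ni; rewrite /block_fun insubF// ltnNge ni. Qed.

Variant ord_or_ge (n i : nat) : Type :=
  | OrdLt (k : 'I_n) of i = k | OrdGe of (n <= i)%N.

Lemma ord_or_geP n i : ord_or_ge n i.
Proof.
by case: (leqP n i) => [|lt]; [exact: OrdGe | exact: (@OrdLt _ _ (Ordinal lt))].
Qed.

Lemma block_fun_mul n (p q : 'M[R]_n) v i :
  block_fun p (block_fun q v) i = block_fun (p *m q) v i.
Proof.
have [k ->|ni] := ord_or_geP n i; last by rewrite !block_fun_ge.
rewrite !block_fun_lt.
under eq_bigr do rewrite block_fun_lt mulr_sumr.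
rewrite exchange_big/=; apply: eq_bigr => j _.
by rewrite mxE mulr_suml; apply: eq_bigr => l _; rewrite mulrA.
Qed.

Lemma block_fun1 n v i : block_fun (1%:M : 'M[R]_n) v i = v i.
Proof.
have [k ->|ni] := ord_or_geP n i; last by rewrite block_fun_ge.
rewrite block_fun_lt (bigD1 k)//= mxE eqxx mul1r big1 ?addr0// => j /negbTE jk.
by rewrite mxE eq_sym jk mul0r.
Qed.

Lemma block_fun_sum_sqr n (q : 'M[R]_n) v : q^T *m q = 1%:M ->
  \sum_(i < n) block_fun q v i ^+ 2 = \sum_(i < n) v i ^+ 2.
Proof.
move=> qq; pose x : 'cV[R]_n := \col_i v i.
have sumE (y : 'cV[R]_n) : \sum_i y i 0 ^+ 2 = (y^T *m y) 0 0.
  by rewrite mxE; apply: eq_bigr => i _; rewrite mxE expr2.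
transitivity (\sum_i (q *m x) i 0 ^+ 2).
  apply: eq_bigr => i _; rewrite block_fun_lt mxE.
  by congr (_ ^+ 2); apply: eq_bigr => j _; rewrite mxE.
rewrite sumE trmx_mul mulmxA -(mulmxA x^T) qq mulmx1 -sumE.
by apply: eq_bigr => i _; rewrite mxE.
Qed.

Lemma block_fun_sum_sqr_le n (q : 'M[R]_n) (v : l2 R) N : q^T *m q = 1%:M ->
  \sum_(i < N) block_fun q v i ^+ 2 <= `|v| ^+ 2.
Proof.
(* The range is enlarged to contain the whole block, on which only the full sum of squares is
   preserved. *)
move=> qq; apply: le_trans (l2_sum_le v (n + N)).
rewrite -!(big_mkord xpredT (fun i => _ i ^+ 2)).
apply: (@le_trans _ _ (\sum_(0 <= i < n + N) block_fun q v i ^+ 2)).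
  rewrite [leRHS](@big_cat_nat _ _ _ N)//= ?leq_addl// lerDl.
  by apply: sumr_ge0 => i _; rewrite sqr_ge0.
rewrite (@big_cat_nat _ _ _ n)//= ?leq_addr//.
rewrite [leRHS](@big_cat_nat _ _ _ n)//= ?leq_addr// !big_mkord.
rewrite block_fun_sum_sqr// lerD2l !big_nat ler_sum// => i /andP[ni _].
by rewrite block_fun_ge.
Qed.

Definition block_op n (q : 'M[R]_n) (v : l2 R) : l2 R := to_l2 (block_fun q v).

Lemma block_opE n (q : 'M[R]_n) (v : l2 R) i : q^T *m q = 1%:M ->
  block_op q v i = block_fun q v i.
Proof.
move=> qq; rewrite to_l2E//; apply: (@square_summable_bound _ _ (`|v| ^+ 2)) => N.
exact: block_fun_sum_sqr_le.
Qed.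

Lemma block_op_norm_le n (q : 'M[R]_n) (v : l2 R) : q^T *m q = 1%:M ->
  `|block_op q v| <= `|v|.
Proof.
move=> qq; apply: l2_norm_le => // N.
under eq_bigr do rewrite block_opE//.
exact: block_fun_sum_sqr_le.
Qed.

Lemma block_op_mul n (p q : 'M[R]_n) (v : l2 R) :
  p^T *m p = 1%:M -> q^T *m q = 1%:M -> p *m q = 1%:M ->
  block_op p (block_op q v) = v.
Proof.
move=> pp qq pq; apply: l2_eq => i; rewrite block_opE//.
rewrite -[RHS](@block_fun1 n v i) -pq -block_fun_mul; congr (block_fun p _ i).
by apply/funext => j; rewrite block_opE.
Qed.

Lemma block_op_linear n (q : 'M[R]_n) (a : R) (u v : l2 R) : q^T *m q = 1%:M ->
  block_op q (a *: u + v) = a *: block_op q u + block_op q v.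
Proof.
move=> qq; apply: l2_eq => i; rewrite l2_addE l2_scaleE !block_opE//.
have [k ->|ni] := ord_or_geP n i; last by rewrite !block_fun_ge.
rewrite !block_fun_lt mulr_sumr -big_split; apply: eq_bigr => j _ /=.
transitivity (q k j * (a * u j + v j)) => //; by rewrite mulrDr mulrCA.
Qed.

(** The vector changes only in its first [n] coordinates, and finitely supported vectors lie in
    every [diag_dom]. *)
Lemma block_op_dom n (q : 'M[R]_n) lam (v : l2 R) : q^T *m q = 1%:M ->
  diag_dom lam v -> diag_dom lam (block_op q v).
Proof.
move=> qq dv; rewrite -[block_op q v](subrK v) -[_ - v]scale1r.
apply: diag_domP => //; apply: (@diag_dom_finite _ _ _ n) => i ni.
by rewrite l2_addE l2_oppE block_opE// block_fun_ge// subrr.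
Qed.

Lemma block_op_isometry n (q : 'M[R]_n) lam : q^T *m q = 1%:M ->
  diag_isometry lam (block_op q) (block_op q^T).
Proof.
move=> qq; have qq' : q *m q^T = 1%:M by exact: mulmx1C.
have tt : q^T^T *m q^T = 1%:M by rewrite trmxK.
have KT v : block_op q^T (block_op q v) = v by exact: block_op_mul.
split.
- by move=> *; exact: block_op_linear.
- by move=> *; exact: block_op_linear.
- exact: KT.
- by move=> v; exact: block_op_mul.
- move=> v; apply/eqP; rewrite eq_le block_op_norm_le//=.
  by rewrite -[in leLHS](KT v) block_op_norm_le.
- by move=> v; exact: block_op_dom.
- by move=> v; exact: block_op_dom.
Qed.

End block_isometry.

(** * Bounded operators from matrices with geometrically decaying entries *)

Section rapidly_decaying_matrix.
Context {R : realType}.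
Implicit Types (c : nat -> nat -> R) (v : l2 R).

Lemma sum_half_pow N : \sum_(i < N) (2 ^- i : R) = 2 - 2 * 2 ^- N.
Proof.
elim: N => [|N IH]; first by rewrite big_ord0 expr0 invr1; lra.
by rewrite big_ord_recr/= IH exprS invfM; field; rewrite expf_neq0.
Qed.

Definition half_pow : l2 R := to_l2 (fun i => 2 ^- i).

Lemma half_powE i : half_pow i = 2 ^- i.
Proof.
rewrite to_l2E//; apply: (@square_summable_bound _ _ 2) => N.
apply: (@le_trans _ _ (\sum_(i < N) (2 ^- i : R))).
  apply: ler_sum => j _; rewrite -[leRHS]expr1 ler_wiXn2l ?invr_ge0 ?exprn_ge0//.
  by rewrite invf_le1 ?exprn_gt0// exprn_ege1// ler1n.
by rewrite sum_half_pow gerBl mulr_ge0// invr_ge0 exprn_ge0.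
Qed.

Definition mx_op c v := to_l2 (fun i => l2_dot (to_l2 (c i)) v).

Variables (c : nat -> nat -> R) (K : R).
Hypothesis K0 : 0 <= K.
Hypothesis cK : forall i j, `|c i j| <= K * (2 ^- i * 2 ^- j).

Lemma mx_rowE i j : to_l2 (c i) j = c i j.
Proof.
rewrite to_l2E//; apply: (@square_summable_le _ _ half_pow (K * 2 ^- i)) => k.
by rewrite half_powE (le_trans (cK i k))// mulrA [`|2 ^- k|]ger0_norm.
Qed.

Lemma mx_coord_le i v :
  `|l2_dot (to_l2 (c i)) v| <= K * `|half_pow| * `|v| * `|half_pow i|.
Proof.
rewrite (le_trans (l2_dot_le _ _))//.
have h : `|to_l2 (c i)| <= K * 2 ^- i * `|half_pow|.
  apply: l2_norm_le_mul => [|j]; first exact: mulr_ge0.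
  by rewrite mx_rowE half_powE (le_trans (cK i j))// mulrA [`|2 ^- j|]ger0_norm.
rewrite (le_trans (ler_wpM2r (normr_ge0 v) h))// half_powE ger0_norm//.
by rewrite le_eqVlt; apply/orP; left; apply/eqP; ring.
Qed.

Lemma mx_opE v i : mx_op c v i = l2_dot (to_l2 (c i)) v.
Proof.
rewrite to_l2E//; apply: (@square_summable_le _ _ half_pow) => j.
exact: mx_coord_le.
Qed.

(** The entries are dominated by [K] times the rank one matrix of [half_pow] with itself. *)
Lemma mx_op_norm v : `|mx_op c v| <= K * `|half_pow| ^+ 2 * `|v|.
Proof.
have -> : K * `|half_pow| ^+ 2 * `|v| = K * `|half_pow| * `|v| * `|half_pow| by ring.
apply: l2_norm_le_mul => [|i]; first by rewrite !mulr_ge0.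
by rewrite mx_opE mx_coord_le.
Qed.

Lemma mx_op_linear (a : R) u v : mx_op c (a *: u + v) = a *: mx_op c u + mx_op c v.
Proof.
apply: l2_eq => i; rewrite l2_addE l2_scaleE !mx_opE.
by rewrite l2_dotDr l2_dotZr.
Qed.

End rapidly_decaying_matrix.

(** * Inductive construction of finite matrices with the given graph and eigenvalues *)

Section graph_matrices.
Context {R : realType} (G : rel nat).
Hypothesis G_sym : symmetric G.
Variable lam : nat -> R.
Hypothesis lam_inj : injective lam.

(** The weight of an edge depends only on its larger endpoint, so that adding vertex [n] introduces
    the single parameter [t n]. *)
Definition graph_entry (d t : nat -> R) i j : R :=
  if i == j then d i else if G i j then t (maxn i j) else 0.

Definition graph_mx n (d t : nat -> R) : 'M[R]_n :=
  \matrix_(i, j) graph_entry d t i j.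

Lemma graph_entry_sym d t i j : graph_entry d t i j = graph_entry d t j i.
Proof.
rewrite /graph_entry G_sym maxnC eq_sym.
by case: eqP => [->|].
Qed.

Lemma graph_mx_tr n d t : (graph_mx n d t)^T = graph_mx n d t.
Proof. by apply/matrixP => i j; rewrite !mxE graph_entry_sym. Qed.

Definition graph_stage n (s : (nat -> R) * (nat -> R)) :=
  regular_spectrum (fun i : 'I_n => lam i) (graph_mx n s.1 s.2) /\
  forall i, (n <= i)%N -> s.1 i = lam i.

Definition graph_step e n (s s' : (nat -> R) * (nat -> R)) :=
  [/\ forall i, `|s'.1 i - s.1 i| <= e, forall i, i != n -> s'.2 i = s.2 i,
      0 < s'.2 n & s'.2 n <= e].

Lemma graph_stage0 : graph_stage 0 (lam, fun=> 0).
Proof.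
split => //; split; first by case.
by rewrite unitmxE det_mx00 unitr1.
Qed.

Lemma graph_stageS n s e : 0 < e -> graph_stage n s ->
  exists s', graph_stage n.+1 s' /\ graph_step e n s s'.
Proof.
case: s => d t e0 [/= sp dn].
(* Weight 0 first decouples vertex [n], so the spectrum extends by [lam n]. The direction [E] then
   switches on all edges from [n] to earlier vertices at once. *)
pose t0 k := if k == n then 0 else t k.
pose E : 'M[R]_n.+1 := \matrix_(i, j)
  if i == j then 0 else if G i j && (maxn i j == n) then 1 else 0.
have lift_val (i : 'I_n) : lift ord_max i = i :> nat by rewrite lift_max.
have sp' : regular_spectrum (fun i : 'I_n.+1 => lam i) (graph_mx n.+1 d t0).
  apply: (regular_spectrum_extend lam_inj sp).
  - apply/matrixP => i j; have mn : (maxn i j < n)%N by rewrite gtn_max !ltn_ord.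
    by rewrite !mxE !lift_val /graph_entry /t0 (ltn_eqF mn).
  - move=> j; rewrite mxE lift_val /graph_entry /= gtn_eqF//.
    by rewrite (maxn_idPl (ltnW (ltn_ord j))) /t0 eqxx if_same.
  - by rewrite mxE /graph_entry eqxx dn.
have [tau [delta [/andP[tau0 taue] de sp2]]] := regular_spectrum_perturb E sp' e0.
pose d' i := if insub i : option 'I_n.+1 is Some k then d i + delta 0 k else d i.
pose t' k := if k == n then tau else t k.
exists (d', t'); split; split => //=.
- rewrite (_ : graph_mx _ _ _ = graph_mx n.+1 d t0 + tau *: E + diag_mx delta)//.
  apply/matrixP => i j; rewrite !mxE /graph_entry /d' /t' /t0 valK.
  case: (eqVneq i j) => [eij|ij].
    by rewrite -eij !eqxx mulr1n mulr0 addr0.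
  rewrite (negbTE (ij : i != j :> nat)) mulr0n addr0; case: ifP => _ /=.
    by case: eqP => _; rewrite ?mulr1 ?add0r// mulr0 addr0.
  by rewrite mulr0 addr0.
- by move=> i ni; rewrite /d' insubF ?dn ?(ltnW ni)// ltnNge ni.
- move=> i; rewrite /d'; case: insubP => [k _ ki|_]; last by rewrite subrr normr0 ltW.
  by rewrite addrC addKr ltW.
- by move=> i /negbTE; rewrite /t' => ->.
- by rewrite /t' eqxx.
- by rewrite /t' eqxx ltW.
Qed.

Lemma graph_stage_sequence : exists s : nat -> (nat -> R) * (nat -> R),
  forall n, graph_stage n (s n) /\ graph_step (8 ^- n) n (s n) (s n.+1).
Proof.
have e0 n : 0 < 8 ^- n :> R by rewrite invr_gt0 exprn_gt0.
(* Validity of the stage is put as a premise inside the existential, so that choice gives a function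
   on all states, valid or not. *)
have /choice[f fP] : forall p : nat * ((nat -> R) * (nat -> R)), exists s',
    graph_stage p.1 p.2 ->
    graph_stage p.1.+1 s' /\ graph_step (8 ^- p.1) p.1 p.2 s'.
  move=> [n s]; have [st|] := pselect (graph_stage n s); last by exists s.
  by have [s' s'P] := graph_stageS (e0 n) st; exists s'.
pose s := fix s n := if n is m.+1 then f (m, s m) else (lam, fun=> 0).
have sP n : graph_stage n (s n).
  elim: n => [|n IH]; first exact: graph_stage0.
  by have [] := fP (n, s n) IH.
by exists s => n; split => //; have [] := fP (n, s n) (sP n).
Qed.

End graph_matrices.

(** * The limit operator and its approximation by conjugates of the diagonal one *)

Section graph_operator.
Context {R : realType} (G : rel nat).
Hypothesis G_sym : symmetric G.
Variable lam : nat -> R.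
Hypothesis lam_inj : injective lam.

Lemma graph_limit : exists (d t : nat -> R) (s : nat -> nat -> R),
  [/\ forall n, 0 < t n <= 8 ^- n,
      forall n i, `|d i - s n i| <= 2 / 2 ^+ n,
      forall n i, (n <= i)%N -> s n i = lam i &
      forall n i, (i < n)%N ->
        \det ((lam i)%:M - graph_mx G n (s n) t) = 0].
Proof.
have [s sP] := graph_stage_sequence G lam_inj.
(* Weight [n] is set in the step from [n] to [n + 1], and no later step changes it. *)
pose t n := (s n.+1).2 n.
have tE n m : (m < n)%N -> (s n).2 m = t m.
  elim: n => // n IH; rewrite ltnS leq_eqVlt => /orP[/eqP->//|mn].
  have [_ [_ sn _ _]] := sP n; rewrite sn; first exact: IH.
  by rewrite (ltn_eqF mn).
have /choice[d dP] : forall i, exists l, forall n, `|(s n).1 i - l| <= 2 * 1 / 2 ^+ n.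
  move=> i; apply: (@geo_cauchy_real _ (fun n => (s n).1 i)) => n.
  have [_ [+ _ _ _]] := sP n => /(_ i) /le_trans; apply; rewrite div1r.
  by rewrite lef_pV2 ?posrE ?exprn_gt0// lerXn2r ?nnegrE// ler_nat.
exists d, t, (fun n => (s n).1); split.
- by move=> n; have [_ [_ _ t0 t1]] := sP n; rewrite /t t0.
- by move=> n i; rewrite distrC; have := dP i n; rewrite mulr1.
- by move=> n i ni; have [[_ ->]] := sP n.
- move=> n i ni; have [[[+ _] _] _] := sP n => /(_ (Ordinal ni)) /=.
  rewrite (_ : graph_mx G n (s n).1 (s n).2 = graph_mx G n (s n).1 t)//.
  apply/matrixP => k l; rewrite !mxE /graph_entry tE//.
  by rewrite gtn_max !ltn_ord.
Qed.

Lemma graph_operator : exists T : partial_op (l2 R),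
  [/\ approximately_diagonal lam T, forall i, dom T (l2_basis R i),
      forall i j, std_matrix T i j = std_matrix T j i &
      graph_of_matrix G (std_matrix T)].
Proof.
have [d [t [s [tP dP slam sdet]]]] := graph_limit.
(* The off-diagonal part. [T] is [D] plus two bounded operators, the diagonal drift [d - lam] and
   [c], so it keeps the domain of [D]. *)
pose c i j := if i == j then 0 else if G i j then t (maxn i j) else 0 : R.
have tge0 k : 0 <= t k by case/andP: (tP k) => /ltW.
(* Since [8 = 2 ^ 3], the step size leaves one factor for each of [n], [i] and [j], all at most
   [maxn i j]. The case [n = 0] gives boundedness; general [n] makes the entries outside the block
   of size [n] small. *)
have c_le i j n : (n <= maxn i j)%N -> `|c i j| <= 2 ^- n * (2 ^- i * 2 ^- j).
  move=> nij; have p0 k : 0 < 2 ^- k :> R by rewrite invr_gt0 exprn_gt0.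
  rewrite /c; case: eqP => _; first by rewrite normr0 !mulr_ge0 ?ltW.
  case: ifP => _; last by rewrite normr0 !mulr_ge0 ?ltW.
  rewrite ger0_norm//; have /andP[_ /le_trans] := tP (maxn i j); apply.
  rewrite -!invfM -!exprD lef_pV2 ?posrE ?exprn_gt0//.
  rewrite -[8]/((2 * 2 * 2)%N%:R) -natrX -natrX ler_nat.
  rewrite (_ : (2 * 2 * 2 = 2 ^ 3)%N)// -expnM leq_exp2l//.
  by rewrite !mulSn mul0n addn0 !leq_add ?leq_maxl ?leq_maxr.
have cK i j : `|c i j| <= 1 * (2 ^- i * 2 ^- j).
  by have := c_le i j 0%N (leq0n _); rewrite expr0 invr1.
have c1 : (0 : R) <= 1 by [].
have bK i : `|d i - lam i| <= 2.
  by have := dP 0%N i; rewrite slam// expr0 divr1.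
pose B v := diag_op (fun i => d i - lam i) v + mx_op c v.
have BE v i : B v i = (d i - lam i) * v i + l2_dot (to_l2 (c i)) v.
  rewrite /B l2_addE (mx_opE c1 cK); congr (_ + _).
  by rewrite diag_opE//; exact: diag_dom_bounded bK.
pose Tf v := diag_op lam v + B v.
have Tlin (a : R) u v : diag_dom lam u -> diag_dom lam v ->
    Tf (a *: u + v) = a *: Tf u + Tf v.
  move=> du dv; rewrite /Tf /B diag_op_linear// (mx_op_linear c1 cK).
  rewrite diag_op_linear; try exact: diag_dom_bounded bK.
  by rewrite !scalerDr [X in _ + X = _]addrACA [LHS]addrACA.
pose T := PartialOp (diag_dom0 lam) (@diag_domP _ lam) Tlin.
have TE v i : T v i = diag_op lam v i + B v i by [].
have di j : diag_dom lam (l2_basis R j).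
  by apply: (@diag_dom_finite _ _ _ j.+1) => k jk; rewrite l2_basisE gtn_eqF.
have stdE i j : std_matrix T i j = graph_entry G d t i j.
  rewrite /std_matrix l2_dot_basis TE BE (diag_opE i (di j)).
  rewrite l2_dotC l2_dot_basis (mx_rowE cK) l2_basisE /c /graph_entry.
  by case: eqP => [->|_]; rewrite ?mulr1 ?mulr0 ?add0r ?addr0// subrKC.
exists T; split; [|exact: di| |]; last first.
- move=> i j /negbTE ij; rewrite stdE /graph_entry ij.
  by case: ifP => _; rewrite ?eqxx// gt_eqF//; case/andP: (tP (maxn i j)).
- by move=> i j; rewrite !stdE graph_entry_sym.
split; first by [].
move=> delta delta0.
(* The 2 accounts for the remaining diagonal drift after stage [n], the square for the entries
   outside the block. *)
pose kappa : R := 2 + `|half_pow : l2 R| ^+ 2.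
have [n /(_ n (leqnn n)) nd] := geo_small kappa delta0.
have [Q [QQ QA]] : exists Q : 'M[R]_n, Q *m Q^T = 1%:M /\
    Q *m graph_mx G n (s n) t = diag_mx (\row_i lam i) *m Q.
  apply: orthogonal_diagonalization.
  - by move=> i j /lam_inj /val_inj.
  - exact: graph_mx_tr.
  - by move=> i; exact: sdet.
have QtQ : Q^T *m Q = 1%:M by exact: mulmx1C.
have AE : graph_mx G n (s n) t = Q^T *m diag_mx (\row_i lam i) *m Q.
  by rewrite -mulmxA -QA mulmxA QtQ mul1mx.
have QT1 : Q^T^T *m Q^T = 1%:M by rewrite trmxK.
exists (block_op Q^T), (block_op Q).
have UU : diag_isometry lam (block_op Q^T) (block_op Q).
  by have := block_op_isometry lam QT1; rewrite trmxK.
split; first exact: UU.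
move=> w dw.
pose b' i := d i - s n i.
have b'K i : `|b' i| <= 2 / 2 ^+ n by exact: dP.
pose c' i j := if (i < n)%N && (j < n)%N then 0 else c i j.
have c'K i j : `|c' i j| <= 2 ^- n * (2 ^- i * 2 ^- j).
  rewrite /c'; case: ifP => [_|/negbT].
    by rewrite normr0 !mulr_ge0 ?invr_ge0 ?exprn_ge0.
  by rewrite -gtn_max -leqNgt => /c_le.
have n0 : 0 <= 2 ^- n :> R by rewrite invr_ge0 exprn_ge0.
(* The conjugate of [D] is the stage [n] matrix completed by [lam i] for [i >= n]. What is left of
   [T] is the later drift [b'] and the entries [c'] outside the block. *)
have -> : T w - block_op Q^T (diag_op lam (block_op Q w)) =
    diag_op b' w + mx_op c' w.
  apply: l2_eq => i; rewrite l2_addE [LHS]l2_addE l2_oppE.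
  rewrite (mx_opE n0 c'K) (diag_opE i (diag_dom_bounded w b'K)).
  rewrite TE BE (diag_opE i dw) (block_opE _ _ QT1).
  (* The rows of [c] and [c'] differ only in the first [n] columns, which turns the difference of
     two series into a finite sum. *)
  have dotE : l2_dot (to_l2 (c i)) w - l2_dot (to_l2 (c' i)) w =
      \sum_(j < n) (c i j - c' i j) * w j.
    rewrite -l2_dotNl -l2_dotDl (@l2_dot_finite _ _ _ n) => [|j nj].
      apply: eq_bigr => j _.
      by rewrite l2_addE l2_oppE (mx_rowE cK) (mx_rowE c'K).
    rewrite l2_addE l2_oppE (mx_rowE cK) (mx_rowE c'K) /c'.
    by rewrite [(j < n)%N]ltnNge nj andbF subrr.
  rewrite -[l2_dot (to_l2 (c i)) w](subrK (l2_dot (to_l2 (c' i)) w)) dotE /b'.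
  have [k ->|ni] := ord_or_geP n i; last first.
    rewrite block_fun_ge// (diag_opE i (iso_inv_dom UU dw)) (block_opE _ _ QtQ).
    rewrite block_fun_ge// (slam _ _ ni) big1 => [|j _]; first by ring.
    by rewrite /c' ltnNge ni subrr mul0r.
  rewrite block_fun_lt.
  have -> : \sum_(j < n) Q^T k j * diag_op lam (block_op Q w) j =
      \sum_(j < n) graph_mx G n (s n) t k j * w j.
    rewrite AE; under [RHS]eq_bigr do rewrite mxE mulr_suml.
    rewrite exchange_big/=; apply: eq_bigr => j _.
    rewrite (diag_opE j (iso_inv_dom UU dw)) (block_opE _ _ QtQ) block_fun_lt.
    rewrite !mulr_sumr; apply: eq_bigr => l _.
    by rewrite mul_mx_diag !mxE; ring.
  have -> : \sum_(j < n) graph_mx G n (s n) t k j * w j =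
      s n k * w k + \sum_(j < n) (c k j - c' k j) * w j.
    rewrite [LHS](bigD1 k)//= [in RHS](bigD1 k)//= mxE /graph_entry eqxx.
    rewrite {1}/c {1}/c' ltn_ord /= /c eqxx subrr mul0r add0r; congr (_ + _).
    apply: eq_bigr => j jk; rewrite mxE /graph_entry /c' !ltn_ord subr0.
    by rewrite /c (inj_eq val_inj) eq_sym (negbTE jk).
  by ring.
rewrite (le_trans (ler_normD _ _))//.
have h1 := diag_op_norm w b'K; have h2 := mx_op_norm n0 c'K w.
rewrite (le_trans (lerD h1 h2))//.
apply: (@le_trans _ _ (kappa / 2 ^+ n * `|w|)); last first.
  by rewrite ler_wpM2r// ltW.
by rewrite le_eqVlt; apply/orP; left; apply/eqP; rewrite /kappa; ring.
Qed.

End graph_operator.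

Theorem theorem3p6 (R : realType) (G : rel nat) (Lambda : set R)
    (G_sym : symmetric G) (G_irr : irreflexive G)
    (Lambda_closed : closed Lambda) (Lambda_inf : infinite_set Lambda) :
  exists T : partial_op (l2 R),
    [/\ densely_defined T, self_adjoint T,
        spectrum T = approx_point_spectrum T /\
        spectrum T = [set (x%:C)%C | x in Lambda] &
        [/\ forall i, dom T (l2_basis R i),
            forall i j, std_matrix T i j = std_matrix T j i &
            graph_of_matrix G (std_matrix T)]].
Proof.
have [lam [lam_inj lamL lam_dense]] := injective_dense_sequence Lambda_inf.
have [T [Tlam Tdom Tsym TG]] := graph_operator G_sym lam_inj.
exists T; split => //.
- exact: approx_diag_dense Tlam.
- exact: approx_diag_self_adjoint Tlam.
- exact: approx_diag_spectrum Tlam _ lamL lam_dense.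
Qed.
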